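(* Let $r \geq 3$ be an integer and let $G$ be an $r$-connected graph of Euler genus $\gamma \geq 0$. Then $\kappa_\rho(G) \geq \frac{1}{27}(\gamma+1)^{-1/r}$. Furthermore, when $\gamma \leq 2$: if $r = 3$ then $\kappa_\rho(G) \geq \frac{21}{256}$; if $r = 4$ then $\kappa_\rho(G) \geq \frac{5}{27}$; if $r = 5$ then $\kappa_\rho(G) \geq \frac{49}{192}$; if $r = 6$ then $\kappa_\rho(G) \geq \frac{3}{10}$.
   Context: For a tree $T$, $\Lambda(T)$ denotes its set of leaves. For a connected graph $G$, $\tau_G$ is the set of spanning trees of $G$. The robust connectivity of $G$ is $\kappa_\rho(G) = \min_{\emptyset \neq R \subseteq V(G)} \max_{T \in \tau_G} \frac{|R \cap \Lambda(T)|}{|R|}$. The Euler genus of a graph is the minimum Euler genus of a surface in which it embeds (a sphere with $k$ handles has Euler genus $2k$, with $k$ cross-caps Euler genus $k$). Graphs are simple. *)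

(* Defs.v *)
From HB Require Import structures.
From mathcomp Require Import all_boot all_order all_algebra.
From mathcomp Require Import boolp reals.

Set Implicit Arguments.
Unset Strict Implicit.
Unset Printing Implicit Defensive.

Import Order.TTheory GRing.Theory Num.Theory.

Record sgraph := SGraph {
  vertex :> finType;
  adj : rel vertex;
  adj_sym : symmetric adj;
  adj_irrefl : irreflexive adj }.
Arguments adj {s} : rename.

Definition r_connected (r : nat) (G : sgraph) : Prop :=
  r < #|G| /\
  forall S : {set G}, #|S| < r ->
    forall x y : G, x \notin S -> y \notin S ->
      connect [rel u v | [&& u \notin S, v \notin S & adj u v]] x y.

Section SpanningTrees.
Variable G : sgraph.
Implicit Types (F : {set {set G}}) (K : {set G}).

Definition edges : {set {set G}} :=
  [set [set p.1; p.2] | p : G * G & adj p.1 p.2].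

(* Spanning subgraphs of G are identified with their edge sets F. *)
Definition edge_rel F : rel G := [rel x y | [set x; y] \in F].

Definition spanning_tree F : Prop :=
  [/\ F \subset edges,
      forall x y : G, connect (edge_rel F) x y &
      forall c : seq G, ucycle (edge_rel F) c -> size c < 3].

Definition spanning_trees : {set {set {set G}}} :=
  [set F | `[< spanning_tree F >]].

Definition leaves F : {set G} := [set x | #|[set f in F | x \in f]| == 1].

(* The default values 0 and 1 do not affect the extrema: every ratio lies in
   [0, 1], and for connected nonempty G both index sets are nonempty. *)
Definition robust_connectivity (R : realType) : R :=
  \big[Num.min/1%R]_(K : {set G} | K != set0)
   \big[Num.max/0%R]_(F in spanning_trees)
     (#|K :&: leaves F|%:R / #|K|%:R)%R.
End SpanningTrees.

(* A cell decomposition of a closed connected surface, orientable or not, given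
   by its flags (incident vertex-edge-face triples, as in the barycentric
   subdivision): [fl_i] moves a flag to the one that differs from it exactly in
   its cell of dimension i.  Fixed-point freeness excludes boundary.  Loops and
   multiple edges are allowed. *)
Record surface_map := SurfaceMap {
  flag :> finType;
  fl0 : flag -> flag;
  fl1 : flag -> flag;
  fl2 : flag -> flag;
  fl0K : involutive fl0;
  fl1K : involutive fl1;
  fl2K : involutive fl2;
  fl0_free : forall d, fl0 d != d;
  fl1_free : forall d, fl1 d != d;
  fl2_free : forall d, fl2 d != d;
  fl02C : forall d, fl0 (fl2 d) = fl2 (fl0 d);
  fl02_free : forall d, fl0 (fl2 d) != d;
  map_conn :
    n_comp [rel d d' | [|| fl0 d == d', fl1 d == d' | fl2 d == d']] flag = 1 }.

Section SurfaceMaps.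
Variable M : surface_map.

(* The i-cells are the orbits of the two involutions other than [fl_i]. *)
Definition vertex_rel : rel M := [rel d d' | (fl1 d == d') || (fl2 d == d')].
Definition edge_cell_rel : rel M := [rel d d' | (fl0 d == d') || (fl2 d == d')].
Definition face_rel : rel M := [rel d d' | (fl0 d == d') || (fl1 d == d')].

Definition same_vertex : rel M := connect vertex_rel.

Definition euler_char : int :=
  ((n_comp vertex_rel M)%:Z - (n_comp edge_cell_rel M)%:Z
   + (n_comp face_rel M)%:Z)%R.

Definition orientable : Prop :=
  exists c : M -> bool, forall d : M,
    [/\ c (fl0 d) = ~~ c d, c (fl1 d) = ~~ c d & c (fl2 d) = ~~ c d].
End SurfaceMaps.

(* The sphere is [Handles 0]; [Crosscaps k] is a surface only for k > 0. *)
Inductive surface := Handles of nat | Crosscaps of nat.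

Definition surface_euler_genus (S : surface) : nat :=
  match S with Handles k => k.*2 | Crosscaps k => k end.

(* [M] decomposes a surface homeomorphic to [S], by the classification of closed
   surfaces; [cellulates M (Crosscaps 0)] never holds. *)
Definition cellulates (M : surface_map) (S : surface) : Prop :=
  match S with
  | Handles k => orientable M /\ euler_char M = (2 - (k.*2)%:Z)%R
  | Crosscaps k => ~ orientable M /\ euler_char M = (2 - k%:Z)%R
  end.

(* G is a subgraph of the 1-skeleton of M; [f x] is a flag at the image of the
   vertex x. *)
Definition in_skeleton (G : sgraph) (M : surface_map) : Prop :=
  exists f : G -> M,
    (forall x y, same_vertex (f x) (f y) -> x = y) /\
    (forall x y, adj x y ->
       exists d, same_vertex (f x) d /\ same_vertex (f y) (fl0 d)).

(* An embedding in S, cellular or not, is the same as being drawn in the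
   1-skeleton of some cell decomposition of S. *)
Definition embeds (G : sgraph) (S : surface) : Prop :=
  exists M : surface_map, cellulates M S /\ in_skeleton G M.

Definition has_euler_genus (G : sgraph) (g : nat) : Prop :=
  (exists S, embeds G S /\ surface_euler_genus S = g) /\
  (forall S, embeds G S -> g <= surface_euler_genus S).

(* Main.v *)
Require Import Defs.
From mathcomp Require Import all_boot all_order all_algebra.
From mathcomp Require Import boolp reals exp.
From mathcomp Require Import zify ring lra.
Import Order.TTheory GRing.Theory Num.Theory.
Local Open Scope ring_scope.

Set Implicit Arguments.
Unset Strict Implicit.
Unset Printing Implicit Defensive.

(** A set of vertices [X] consists of leaves of some spanning tree as soon as
    [G - X] is connected and every vertex of [X] has a neighbour outside [X].
    The edges of a maximum cut connect [G], so one of its two sides contains a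
    set [A] of at least half of the vertices of the given set [K] such that [G]
    stays connected when the edges inside [A] are deleted; this property passes
    to the subsets of [A].

    While [G - A] is disconnected, put back into the graph a vertex of [A] that
    is adjacent to as many components as possible.  With [z] vertices in [A] and
    [k] components, each of which has at least [r] neighbours in [A], there is a
    vertex that sees [d >= max(2, r k / z)] components, and the step leads to
    [(z - 1, k - d + 1)].  A piecewise linear potential is nondecreasing along
    these steps and bounds from below the final size of [A].

    The initial value of [k] is bounded by Euler's formula for the bipartite
    minor on [A] and the components of [G - A]: [r k <= 2 (z + k) + 2 g - 4].
    For maps given by flags, Euler's inequality for a subgraph follows by adding
    edges one at a time, since an edge that joins two components of the subgraph
    has the same region on both sides, by a parity argument. *)

(** * Components of relations *)

Local Open Scope nat_scope.

(** A path that starts outside a closed set never enters it, so its steps can be replaced one by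
    one. *)
Lemma connect_outside (T : finType) (r r' : rel T) (P : {pred T}) :
  closed r P -> (forall x y, x \notin P -> r x y -> connect r' x y) ->
  forall x y, x \notin P -> connect r x y -> connect r' x y.
Proof.
move=> clP sub x y xP /connectP[p]; elim: p x xP => [|z p IH] x xP /=.
  by move=> _ ->; apply: connect0.
case/andP=> xz /IH{}IH /IH; rewrite -(clP _ _ xz) => {}IH.
exact: connect_trans (sub _ _ xP xz) (IH xP).
Qed.

Lemma n_comp_le_label (T : finType) (e : rel T) (U : finType) (lab : T -> U)
    (S : {set U}) (P : {pred T}) :
  connect_sym e ->
  (forall x, x \in P -> lab x \in S) ->
  (forall x y, x \in P -> y \in P -> lab x = lab y -> connect e x y) ->
  n_comp e P <= #|S|.
Proof.
move=> sym_e labS labP; rewrite /n_comp_mem -(@card_in_image _ _ lab).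
  apply/subset_leq_card/subsetP=> u /imageP[x]; rewrite !inE => /andP[_ xP] ->.
  exact: labS.
move=> x y; rewrite !inE => /andP[/eqP rx xP] /andP[/eqP ry yP] /(labP _ _ xP yP).
by move/(fingraph.rootP sym_e); rewrite rx ry.
Qed.

Lemma n_comp_gt0 (T : finType) (e : rel T) (P : {pred T}) x :
  connect_sym e -> closed e P -> x \in P -> 0 < n_comp e P.
Proof.
move=> sym_e cl xP; apply/card_gt0P; exists (fingraph.root e x); rewrite !inE roots_root //=.
by rewrite -(closed_connect cl (connect_root e x)).
Qed.

Section Components.
Variables (T : finType) (e e' : rel T).
Hypotheses (sym_e : connect_sym e) (sym_e' : connect_sym e').

(** Outside [P] the two relations have the same classes, so the classes inside [P] account for the
    whole difference of the counts. *)
Lemma n_comp_exchange (P : {pred T}) :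
  closed e P -> closed e' P ->
  (forall x y, x \notin P -> e x y -> connect e' x y) ->
  (forall x y, x \notin P -> e' x y -> connect e x y) ->
  n_comp e T + n_comp e' P = n_comp e' T + n_comp e P.
Proof.
move=> cl cl' sub sub'.
suff E : n_comp e [predC P] = n_comp e' [predC P].
  by rewrite (n_compC P e) (n_compC P e') E; lia.
apply: eq_card => x; rewrite !inE /=.
case xP: (x \in P); rewrite ?andbF ?andbT //=.
have nP : x \notin P by rewrite xP.
have E : connect e x =1 connect e' x.
  move=> y; apply/idP/idP; first exact: connect_outside cl sub _ _ nP.
  exact: connect_outside cl' sub' _ _ nP.
by rewrite /roots /fingraph.root (eq_pick E).
Qed.

(** All new edges run between the classes of [x] and [y]. The union of these is closed for both
    relations; if they differ, it holds two classes of [e] and at least one of [e']. *)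
Lemma n_comp_link x y :
  subrel e e' ->
  (forall u v, e' u v -> e u v \/ (u \in connect e x /\ v \in connect e y)
                         \/ (u \in connect e y /\ v \in connect e x)) ->
  n_comp e T <= n_comp e' T + ~~ connect e x y.
Proof.
move=> sub link; case: (boolP (connect e x y)) => [xy|nxy].
  have E : connect e =2 connect e'.
    move=> u v; apply/idP/idP; first by apply: connect_sub => a b /sub; apply: connect1.
    apply: connect_sub => a b /link [|[|]]; first exact: connect1.
      rewrite !inE => -[xa yb]; rewrite sym_e in xa.
      exact: connect_trans xa (connect_trans xy yb).
    rewrite !inE => -[ya xb]; rewrite sym_e in ya; rewrite sym_e in xy.
    exact: connect_trans ya (connect_trans xy xb).
  by rewrite (eq_n_comp E) addn0.
pose P := [predU connect e x & connect e y].
have cl : closed e P.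
  by move=> u v uv; rewrite !inE !(same_connect1r sym_e uv).
have cl' : closed e' P.
  move=> u v /link [/cl//|[|]]; rewrite !inE => -[-> ->]; by rewrite ?orbT.
have E2 : n_comp e P = 2.
  have := n_comp_closure2 sym_e x y; rewrite nxy => <-; apply: eq_n_comp_r => z.
  rewrite !inE; apply/orP/pred0Pn => [[]h|[w /andP[]]].
  - by exists x; rewrite !inE eqxx andbT sym_e.
  - by exists y; rewrite !inE eqxx orbT andbT sym_e.
  by rewrite !inE sym_e => h /orP[] /eqP <-; [left|right].
have xP : x \in P by rewrite !inE connect0.
have := n_comp_gt0 sym_e' cl' xP.
have h1 u v : u \notin P -> e u v -> connect e' u v by move=> _ /sub; apply: connect1.
have h2 u v : u \notin P -> e' u v -> connect e u v.
  rewrite !inE negb_or => /andP[h1' h2'] /link [/connect1//|[|]] [];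
  rewrite inE => h3 _; [by rewrite h3 in h1' | by rewrite h3 in h2'].
have := n_comp_exchange cl cl' h1 h2; rewrite E2; lia.
Qed.
End Components.

(** * Maps on surfaces *)

Lemma even_card_involution (T : finType) (h : T -> T) (S : {set T}) :
  involutive h -> (forall x, h x != x) -> (forall x, x \in S -> h x \in S) ->
  ~~ odd #|S|.
Proof.
move=> hK hfree; have [n] := ubnP #|S|; elim: n S => // n IH S le hS.
case: (set_0Vmem S) => [->|[x xS]]; first by rewrite cards0.
have hxS : h x \in S :\ x by rewrite !inE hfree hS.
rewrite (cardsD1 x) xS (cardsD1 (h x)) hxS /= negbK; apply: IH.
  by move: le; rewrite (cardsD1 x) xS (cardsD1 (h x)) hxS; lia.
move=> y; rewrite !inE => /and3P[yhx yx yS]; rewrite hS // andbT.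
by rewrite (inj_eq (can_inj hK)) yx -[x]hK (inj_eq (can_inj hK)).
Qed.

Lemma involution_eq_sym (T : eqType) (h : T -> T) (x y : T) :
  involutive h -> (h x == y) = (h y == x).
Proof. by move=> hK; apply/eqP/eqP => [<-|<-]; rewrite hK. Qed.

Section Maps.
Variable M : surface_map.
Implicit Types (H S K Z : {set M}) (d x y : M).

Definition edge_inv H :=
  (forall x, (fl0 x \in H) = (x \in H)) /\ (forall x, (fl2 x \in H) = (x \in H)).

(* The classes are the components of the spanning subgraph with edge set [H]. *)
Definition graph_rel H x y :=
  [|| fl1 x == y, fl2 x == y | (x \in H) && (fl0 x == y)].
Arguments graph_rel H x y /.

(* The classes are the faces of that subgraph: faces of the map are merged
   across the edges outside [H]. *)
Definition region_rel H x y :=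
  [|| fl0 x == y, fl1 x == y | (x \notin H) && (fl2 x == y)].
Arguments region_rel H x y /.

Definition edge_orbit d : {set M} := [set d; fl0 d; fl2 d; fl0 (fl2 d)].

Definition boundary S : {set M} := [set x in S | fl2 x \notin S].

Lemma graph_rel_sym H : edge_inv H -> connect_sym (graph_rel H).
Proof.
move=> [H0 _]; apply: sym_connect_sym => x y /=.
rewrite (involution_eq_sym x y (@fl1K M)) (involution_eq_sym x y (@fl2K M)).
congr [|| _, _ | _]; rewrite (involution_eq_sym x y (@fl0K M)).
by case: eqP => [<-|]; rewrite ?andbF // H0.
Qed.

Lemma region_rel_sym H : edge_inv H -> connect_sym (region_rel H).
Proof.
move=> [_ H2]; apply: sym_connect_sym => x y /=.
rewrite (involution_eq_sym x y (@fl1K M)) (involution_eq_sym x y (@fl0K M)).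
congr [|| _, _ | _]; rewrite (involution_eq_sym x y (@fl2K M)).
by case: eqP => [<-|]; rewrite ?andbF // H2.
Qed.

Lemma edge_orbit_id d : d \in edge_orbit d.
Proof. by rewrite !inE eqxx. Qed.

Lemma edge_orbit_inv d : edge_inv (edge_orbit d).
Proof.
split=> x; rewrite !inE.
  rewrite !(can2_eq (@fl0K M) (@fl0K M)) !fl0K.
  by case: (x == d); case: (x == fl2 d); rewrite ?orbT ?orbF //= orbC.
rewrite !(can2_eq (@fl2K M) (@fl2K M)) -!fl02C !fl2K.
by case: (x == d); case: (x == fl0 d); case: (x == fl2 d); rewrite ?orbT ?orbF.
Qed.

(** The freeness conditions on [fl0], [fl2] and their composite keep the four flags of an edge
    distinct. This is the factor 4 wherever edges are counted by flags. *)
Lemma card_edge_orbit d : #|edge_orbit d| = 4.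
Proof.
have f0 x : (x == fl0 x) = false by rewrite eq_sym; apply/negbTE/fl0_free.
have f2 x : (x == fl2 x) = false by rewrite eq_sym; apply/negbTE/fl2_free.
have f02 x : (x == fl0 (fl2 x)) = false by rewrite eq_sym; apply/negbTE/fl02_free.
rewrite /edge_orbit -!setUA !cardsU1 cards1 !inE !f0 !f2 !f02.
by rewrite (can2_eq (@fl0K M) (@fl0K M)) f02 (inj_eq (can_inj (@fl0K M))) f2.
Qed.

Lemma edge_invU H Z : edge_inv H -> edge_inv Z -> edge_inv (H :|: Z).
Proof. by move=> [H0 H2] [Z0 Z2]; split=> x; rewrite !inE ?H0 ?H2 ?Z0 ?Z2. Qed.

Lemma edge_inv_orbit H d : edge_inv H -> d \in H -> edge_orbit d \subset H.
Proof.
move=> [H0 H2] dH; apply/subsetP=> x; rewrite !inE.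
by case/orP=> [/orP[/orP[]|]|] /eqP->; rewrite ?H0 ?H2.
Qed.

(* Boundaries of face sets are even at every vertex, hence on every set of
   vertices, and the edges inside that vertex set are counted twice. *)
Lemma even_boundary S K Z :
  (forall x, x \in S -> fl0 x \in S) -> (forall x, x \in S -> fl1 x \in S) ->
  (forall x, x \in K -> fl1 x \in K) -> (forall x, x \in K -> fl2 x \in K) ->
  (forall x, x \in Z -> fl0 x \in Z) ->
  (forall x, x \in K -> x \in Z -> fl0 x \in K) ->
  ~~ odd #|(boundary S :&: K) :\: Z|.
Proof.
move=> S0 S1 K1 K2 Z0 KZ.
(* [fl1] pairs off all flags of [S :&: K], [fl2] those with both sides in [S], and [fl0] the
   boundary flags in [Z]; the claim is the parity of what is left. *)
have e1 : ~~ odd #|S :&: K|.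
  apply: even_card_involution (@fl1K M) (@fl1_free M) _ => x.
  by rewrite !inE => /andP[/S1-> /K1->].
have e2 : ~~ odd #|[set x in S :&: K | fl2 x \in S]|.
  apply: even_card_involution (@fl2K M) (@fl2_free M) _ => x.
  by rewrite !inE fl2K => /andP[/andP[-> /K2->] ->].
have S0e x : (fl0 x \in S) = (x \in S).
  by apply/idP/idP => [/S0|/S0//]; rewrite fl0K.
have e3 : ~~ odd #|(boundary S :&: K) :&: Z|.
  apply: even_card_involution (@fl0K M) (@fl0_free M) _ => x.
  by rewrite !inE -fl02C !S0e => /andP[/andP[/andP[-> ->] xK] xZ]; rewrite KZ // Z0.
have := cardsID [set x | fl2 x \in S] (S :&: K).
have := cardsID Z (boundary S :&: K).
have -> : (S :&: K) :\: [set x | fl2 x \in S] = boundary S :&: K.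
  by apply/setP=> x; rewrite !inE andbCA andbA.
have -> : (S :&: K) :&: [set x | fl2 x \in S] = [set x in S :&: K | fl2 x \in S].
  by apply/setP=> x; rewrite !inE.
lia.
Qed.

(* Adding an edge to [H] cannot both merge two components and split a face: the
   boundary of the new face would meet a component in an odd number of ends. *)
Lemma bridge_or_same_region H d :
  edge_inv H -> d \notin H ->
  connect (graph_rel H) d (fl0 d) \/
  connect (region_rel (H :|: edge_orbit d)) d (fl2 d).
Proof.
move=> Hinv dH; set H' := H :|: _.
have Hinv' : edge_inv H' by apply: edge_invU => //; apply: edge_orbit_inv.
apply/orP; apply/negPn/negP; rewrite negb_or => /andP[nK nS].
pose S := [set y | connect (region_rel H') d y].
pose K := [set y | connect (graph_rel H) d y].
have clS x y : region_rel H' x y -> x \in S -> y \in S.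
  by rewrite !inE => xy /connect_trans; apply; apply: connect1.
have clK x y : graph_rel H x y -> x \in K -> y \in K.
  by rewrite !inE => xy /connect_trans; apply; apply: connect1.
have := @even_boundary S K H.
(* A boundary flag outside [H] belongs to the new edge. Of its four flags, [nK] takes [fl0 d] out of
   [K] and [nS] takes the two on the other side out of [S], so a single one remains. *)
have -> : (boundary S :&: K) :\: H = [set d].
  apply/setP=> x; rewrite 4!inE [RHS]inE; apply/idP/eqP => [/and3P[xH]|->]; last first.
    by rewrite dH !inE nS !connect0.
  case/andP=> xS x2S xK.
  have : x \in H'.
    apply/negPn/negP => xH'; case/negP: x2S; apply: (clS x) => //=.
    by rewrite xH' eqxx !orbT.
  rewrite !inE (negPf xH) /= => /orP[/orP[/orP[]|]|] /eqP xE //; exfalso.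
  - by move: xK; rewrite xE inE (negPf nK).
  - by case/negP: nS; move: xS; rewrite xE inE.
  - case/negP: nS; rewrite xE in xS.
    have st : region_rel H' (fl0 (fl2 d)) (fl2 d) by rewrite /= fl0K eqxx.
    by have := clS _ _ st xS; rewrite inE.
rewrite cards1 => ev; suff : ~~ odd 1 by []; apply: ev => x.
- by apply: clS; rewrite /= eqxx.
- by apply: clS; rewrite /= eqxx orbT.
- by apply: clK; rewrite /= eqxx.
- by apply: clK; rewrite /= eqxx orbT.
- by rewrite Hinv.1.
- by move=> xK xH; apply: clK xK; rewrite /= xH eqxx !orbT.
Qed.

(** The new edge merges at most two components and splits at most one region, and
    [bridge_or_same_region] forbids that both happen. *)
Lemma n_comp_add_edge H d : edge_inv H -> d \notin H ->
  let H' := H :|: edge_orbit d in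
  n_comp (graph_rel H) M <= n_comp (graph_rel H') M + 1 /\
  n_comp (region_rel H') M + n_comp (graph_rel H) M
    <= n_comp (region_rel H) M + n_comp (graph_rel H') M + 1.
Proof.
move=> Hinv dH H'.
have Hinv' : edge_inv H' by apply: edge_invU => //; apply: edge_orbit_inv.
have dichotomy := bridge_or_same_region Hinv dH.
have g2 x : connect (graph_rel H) x (fl2 x) by apply: connect1; rewrite /= eqxx orbT.
have r0 x : connect (region_rel H') x (fl0 x) by apply: connect1; rewrite /= eqxx.
have gle : n_comp (graph_rel H) M
    <= n_comp (graph_rel H') M + ~~ connect (graph_rel H) d (fl0 d).
  apply: n_comp_link; [exact: graph_rel_sym | exact: graph_rel_sym | |].
    move=> x y /= /or3P[->|->|/andP[xH ->]]; rewrite ?orbT //.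
    by rewrite inE xH !orbT.
  move=> u v /= /or3P[->|->|]; rewrite ?orbT; [by left | by left |].
  rewrite !inE => /andP[/orP[->->|]]; first by rewrite !orbT; left.
  case/orP=> [/orP[/orP[]|]|] /eqP-> /eqP<-; right.
  - by left; rewrite !connect0.
  - by right; rewrite fl0K !connect0.
  - by left; rewrite fl02C !g2.
  - by right; rewrite fl02C -fl02C fl0K fl02C !g2.
have rle : n_comp (region_rel H') M
    <= n_comp (region_rel H) M + ~~ connect (region_rel H') d (fl2 d).
  apply: n_comp_link; [exact: region_rel_sym | exact: region_rel_sym | |].
    move=> x y /= /or3P[->|->|/andP[]]; rewrite ?orbT //.
    by rewrite inE negb_or => /andP[-> _] ->; rewrite !orbT.
  move=> u v /= /or3P[->|->|]; rewrite ?orbT; [by left | by left |].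
  case: (boolP (u \in edge_orbit d)) => [|uO]; last first.
    by rewrite inE negb_or uO andbT => ->; rewrite !orbT; left.
  rewrite !inE => /orP[/orP[/orP[]|]|] /eqP-> /andP[_ /eqP<-]; right.
  - by left; rewrite !connect0.
  - by left; rewrite -fl02C !r0.
  - by right; rewrite fl2K !connect0.
  - by right; rewrite -fl02C fl2K !r0.
by split; [lia | case: dichotomy => h; rewrite h in gle rle *; lia].
Qed.

(** The edges of [H' :\: H] are added one at a time by [n_comp_add_edge], each contributing four
    flags. *)
Lemma n_comp_edge_sets H H' : edge_inv H -> edge_inv H' -> H \subset H' ->
  4 * n_comp (graph_rel H) M <= 4 * n_comp (graph_rel H') M + #|H' :\: H| /\
  4 * n_comp (region_rel H') M + 4 * n_comp (graph_rel H) M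
    <= 4 * n_comp (region_rel H) M + 4 * n_comp (graph_rel H') M + #|H' :\: H|.
Proof.
move=> Hinv Hinv'; have [n] := ubnP #|H' :\: H|.
elim: n H Hinv => // n IH H Hinv le sub.
case: (set_0Vmem (H' :\: H)) => [E|[d]].
  have -> : H = H' by apply/eqP; rewrite eqEsubset sub -setD_eq0 E eqxx.
  by lia.
rewrite inE => /andP[dH dH'].
have Oinv := edge_orbit_inv d.
have O' := edge_inv_orbit Hinv' dH'.
have dis : edge_orbit d :&: H = set0.
  apply/setP=> x; rewrite in_set0 inE; apply/negbTE/negP=> /andP[xO xH].
  case: Hinv => H0 H2.
  by move: xO xH dH; rewrite !inE => /orP[/orP[/orP[]|]|] /eqP->; rewrite ?H0 ?H2 => ->.
have card : #|H' :\: H| = #|H' :\: (H :|: edge_orbit d)| + 4.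
  rewrite -(card_edge_orbit d) -(cardsID (edge_orbit d) (H' :\: H)) addnC.
  congr (_ + _); first by rewrite setDDl.
  congr #|pred_of_set _|; apply/setP=> x; rewrite !inE.
  apply/idP/idP => [/andP[_ ->]//|xO].
  have xO' : x \in edge_orbit d by rewrite !inE.
  rewrite xO (subsetP O' _ xO') !andbT; apply/negP=> xH.
  by have := in_set0 x; rewrite -dis inE xO' xH.
have [s1 s2] := n_comp_add_edge Hinv dH.
have [] := IH (H :|: edge_orbit d).
- exact: edge_invU.
- by lia.
- by rewrite subUset sub O'.
lia.
Qed.

Lemma edge_cell_rel_sym : connect_sym (@edge_cell_rel M).
Proof.
apply: sym_connect_sym => x y; rewrite /edge_cell_rel /=.
by rewrite (involution_eq_sym x y (@fl0K M)) (involution_eq_sym x y (@fl2K M)).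
Qed.

Lemma card_flags_le : #|M| <= 4 * n_comp (@edge_cell_rel M) M.
Proof.
pose rt := fingraph.root (@edge_cell_rel M).
rewrite -sum1_card (partition_big rt (roots (@edge_cell_rel M))) => /=; last first.
  by move=> x _; apply: roots_root edge_cell_rel_sym _.
have -> : n_comp (@edge_cell_rel M) M = \sum_(r | roots (@edge_cell_rel M) r) 1.
  by rewrite sum1_card; apply: eq_card => x; rewrite !inE andbT.
rewrite big_distrr /=; apply: leq_sum => r _; rewrite muln1 sum1_card.
rewrite -(card_edge_orbit r); apply/subset_leq_card/subsetP=> x; rewrite inE => /eqP xr.
have rx : connect (@edge_cell_rel M) r x.
  by rewrite edge_cell_rel_sym -xr; apply: connect_root.
have [O0 O2] := edge_orbit_inv r.
have cl : closed (@edge_cell_rel M) (edge_orbit r).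
  by move=> u v; rewrite /edge_cell_rel /= => /orP[] /eqP<-; rewrite ?O0 ?O2.
by move: (closed_connect cl rx); rewrite edge_orbit_id => /esym; rewrite !inE.
Qed.

Lemma map_connected x y :
  connect [rel d d' | [|| fl0 d == d', fl1 d == d' | fl2 d == d']] x y.
Proof.
set e := (X in connect X).
have sym : connect_sym e.
  apply: sym_connect_sym => u v; rewrite /e /=.
  by rewrite (involution_eq_sym u v (@fl0K M)) (involution_eq_sym u v (@fl1K M))
             (involution_eq_sym u v (@fl2K M)).
have /card_le1P h : #|predI (roots e) M| <= 1 by rewrite -/(n_comp e M) (map_conn M).
have rt z : fingraph.root e z \in predI (roots e) M by rewrite !inE roots_root.
apply/(fingraph.rootP sym)/esym/eqP.
by have := h _ (rt x) (fingraph.root e y); rewrite (rt y) !inE => <-.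
Qed.
End Maps.

Arguments graph_rel {M} H x y /.
Arguments region_rel {M} H x y /.

(** * Euler's inequality for a bipartite minor of a map *)

Section BipartiteMinor.
(** [lab] gives the branch set of the vertex of a flag, with [None] outside the minor. [P] contains
    the branch sets in use, [A] is one side of the bipartition, and the pairs in [E] are the edges
    of the minor, directed out of [A]. *)
Variables (M : surface_map) (L : finType) (lab : M -> option L).
Variables (P A : {set L}) (E : {set L * L}).

(* Edges of the map contracted by the labelling. *)
Definition inner_edges : {set M} := [set x | lab x && (lab x == lab (fl0 x))].

Hypothesis lab_fl1 : forall x, lab (fl1 x) = lab x.
Hypothesis lab_fl2 : forall x, lab (fl2 x) = lab x.
Hypothesis lab_in : forall x l, lab x = Some l -> l \in P.
Hypothesis lab_connected : forall x y, lab x -> lab x = lab y ->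
  connect (graph_rel inner_edges) x y.
Hypothesis E_bip : forall e, e \in E -> e.1 \in A /\ e.2 \notin A.
Hypothesis E_edge : forall e, e \in E ->
  exists x, lab x = Some e.1 /\ lab (fl0 x) = Some e.2.

Lemma inner_edges_inv : edge_inv inner_edges.
Proof.
split=> x; rewrite !inE ?fl02C ?lab_fl2 ?fl0K //.
by rewrite [RHS]andbC eq_sym; case: eqP => [->|]; rewrite ?andbT ?andbF.
Qed.

(** Take a maximal set of inner edges that leaves a single region; this condition stands in for
    acyclicity. By [bridge_or_same_region], an inner edge whose ends are not yet joined could be
    added without cutting the region. *)
Lemma contraction_forest : exists F : {set M},
  [/\ F \subset inner_edges, edge_inv F, forall x y, connect (region_rel F) x y &
      forall x y, lab x -> lab x = lab y -> connect (graph_rel F) x y].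
Proof.
pose ok (F : {set M}) := `[< [/\ F \subset inner_edges, edge_inv F &
                          forall x y, connect (region_rel F) x y] >].
have ok0 : ok set0.
  apply/asboolP; split; first exact: sub0set.
    by split=> x; rewrite !inE.
  move=> x y; have := map_connected x y; apply: connect_sub => u v /= uv.
  by apply: connect1; rewrite /= inE.
have [F maxF _] := maxset_exists ok0.
have [/asboolP[Fsub Finv Fconn] Fmax] := maxsetP maxF; exists F; split=> //.
have step x : x \in inner_edges -> connect (graph_rel F) x (fl0 x).
  move=> xi; have [xF|xF] := boolP (x \in F).
    by apply: connect1; rewrite /= xF eqxx !orbT.
  have [//|reg] := bridge_or_same_region Finv xF.
  have Oinv := edge_orbit_inv x; have F1inv := edge_invU Finv Oinv.
  suff okF1 : ok (F :|: edge_orbit x).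
    have := Fmax _ okF1 (subsetUl _ _) => E1.
    by move: xF; rewrite -E1 inE edge_orbit_id orbT.
  apply/asboolP; split=> //.
    rewrite subUset Fsub; exact: edge_inv_orbit inner_edges_inv xi.
  have sym := region_rel_sym F1inv.
  have r0 y : connect (region_rel (F :|: edge_orbit x)) y (fl0 y).
    by apply: connect1; rewrite /= eqxx.
  have r0' y : connect (region_rel (F :|: edge_orbit x)) (fl0 y) y.
    by rewrite sym.
  move=> u v; have := Fconn u v; apply: connect_sub => {u v} u v.
  rewrite /= => /or3P[h|h|/andP[uF /eqP<-]].
  - by apply: connect1; rewrite /= h.
  - by apply: connect1; rewrite /= h orbT.
  have [|uO] := boolP (u \in edge_orbit x); last first.
    by apply: connect1; rewrite /= inE negb_or uF uO eqxx !orbT.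
  rewrite !inE => /orP[/orP[/orP[]|]|] /eqP->.
  - exact: reg.
  - rewrite -fl02C; exact: connect_trans (r0' _) (connect_trans reg (r0 _)).
  - by rewrite fl2K sym.
  rewrite -fl02C fl2K; apply: connect_trans (r0' _) (connect_trans _ (r0 _)).
  by rewrite sym.
move=> x y lx lxy; have := lab_connected lx lxy; apply: connect_sub => u v.
move=> /= /or3P[h|h|/andP[ui /eqP<-]]; last exact: step.
- by apply: connect1; rewrite /= h.
- by apply: connect1; rewrite /= h orbT.
Qed.

(** One map edge is chosen for each pair in [E], so no two chosen edges become parallel after
    contraction. Since [E] is directed out of [A], the flags of a chosen edge determine its pair.
    [x0] is only a default for pairs outside [E]. *)
Lemma edge_representatives (x0 : M) : exists B : {set M},
  [/\ edge_inv B, 4 * #|E| <= #|B|,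
      forall x, x \in B -> exists a b, [/\ lab x = Some a, lab (fl0 x) = Some b &
                                       (a \in A) = (b \notin A)] &
      forall x y, x \in B -> y \in B -> lab x = lab y -> lab (fl0 x) = lab (fl0 y) ->
        y = x \/ y = fl2 x].
Proof.
have [beta betaP] : exists beta : L * L -> M, forall e, e \in E ->
    lab (beta e) = Some e.1 /\ lab (fl0 (beta e)) = Some e.2.
  apply: (@fin_all_exists _ (fun=> M) (fun e x => e \in E ->
    lab x = Some e.1 /\ lab (fl0 x) = Some e.2)) => e.
  by have [/E_edge[x xP]|] := boolP (e \in E); [exists x | exists x0].
pose B := [set x | [exists e in E, x \in edge_orbit (beta e)]].
have BP x : reflect (exists2 e, e \in E & x \in edge_orbit (beta e)) (x \in B).
  by rewrite inE; apply: exists_inP.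
have Blab x e : e \in E -> x \in edge_orbit (beta e) ->
    (lab x = Some e.1 /\ lab (fl0 x) = Some e.2 /\ (x = beta e \/ x = fl2 (beta e)))
    \/ (lab x = Some e.2 /\ lab (fl0 x) = Some e.1 /\
        (x = fl0 (beta e) \/ x = fl2 (fl0 (beta e)))).
  move=> eE; have [l1 l2] := betaP e eE; rewrite !inE.
  case/orP=> [/orP[/orP[]|]|] /eqP->; [left|right|left|right];
    rewrite ?fl0K ?lab_fl2 ?fl02C ?lab_fl2 -?fl02C ?fl0K ?lab_fl2.
  - by split=> //; split=> //; left.
  - by split=> //; split=> //; left.
  - by split=> //; split=> //; right.
  - by split=> //; split=> //; right.
have Buniq e e' x : e \in E -> e' \in E -> x \in edge_orbit (beta e) ->
    x \in edge_orbit (beta e') -> e = e'.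
  move=> eE eE' /(Blab _ _ eE) h /(Blab _ _ eE') h'.
  have [a1 a2] := E_bip eE; have [a1' a2'] := E_bip eE'.
  case: e e' {eE eE'} a1 a2 a1' a2' h h' => [a b] [a' b'] /= a1 a2 a1' a2'.
  case=> -[-> [-> _]] [] [[E1] [[E2] _]]; rewrite ?E1 ?E2 //.
  - by rewrite -E1 a1 in a2'.
  - by rewrite E1 a1' in a2.
exists B; split.
- split=> x; apply/BP/BP => -[e eE xe]; exists e => //;
    have [o0 o2] := edge_orbit_inv (beta e).
  + by rewrite -o0. + by rewrite o0. + by rewrite -o2. + by rewrite o2.
- pose F (e : L * L) := if e \in E then edge_orbit (beta e) else set0.
  have dis e e' : e != e' -> [disjoint F e & F e'].
    move=> ne; rewrite -setI_eq0; apply/eqP/setP=> x; rewrite in_set0 inE /F.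
    case: ifP => eE; rewrite ?in_set0 //; case: ifP => eE'; rewrite ?in_set0 ?andbF //.
    by apply/negbTE/negP=> /andP[xe xe']; case/eqP: ne; apply: Buniq eE eE' xe xe'.
  have -> : B = \bigcup_e F e.
    apply/setP=> x; apply/BP/bigcupP => [[e eE xe]|[e _]].
      by exists e; rewrite // /F eE.
    by rewrite /F; case: ifP => [eE xe|]; [exists e | rewrite in_set0].
  have := @partition_disjoint_bigcup _ _ nat 0 addn F (fun=> 1) dis.
  rewrite sum1_card => ->.
  rewrite (bigID (mem E)) /= -[X in 4 * X]sum1_card big_distrr /=.
  apply: leq_trans (leq_addr _ _); apply: leq_sum => e eE.
  by rewrite sum1_card /F eE card_edge_orbit.
- move=> x /BP[e eE xe]; have [a1 a2] := E_bip eE.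
  have [[l1 [l2 _]]|[l1 [l2 _]]] := Blab x e eE xe.
    by exists e.1, e.2; rewrite a1 a2.
  by exists e.2, e.1; rewrite a1 (negbTE a2).
move=> x y /BP[e eE xe] /BP[e' eE' ye'].
have hx := Blab _ _ eE xe; have hy := Blab _ _ eE' ye'.
have [a1 a2] := E_bip eE; have [a1' a2'] := E_bip eE'.
have Ee : lab x = lab y -> lab (fl0 x) = lab (fl0 y) -> e = e'.
  case: e e' {eE eE' xe ye'} a1 a2 a1' a2' hx hy => [a b] [a' b'] /= a1 a2 a1' a2'.
  case=> -[-> [-> _]] [] [-> [-> _]] [E1] [E2]; rewrite ?E1 ?E2 //.
  - by rewrite -E1 a1 in a2'.
  - by rewrite E1 a1' in a2.
move=> lxy lxy0; move: {Ee}(Ee lxy lxy0) => Ee; subst e'.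
case: hx hy => -[l1 [_ hx]] [] [l2 [_ hy]].
- by case: hx hy => -> [] ->; rewrite ?fl2K; [left|right|right|left].
- by move: lxy; rewrite l1 l2 => -[E1]; rewrite E1 (negbTE a2) in a1.
- by move: lxy; rewrite l1 l2 => -[E1]; rewrite E1 a1 in a2.
- by case: hx hy => -> [] ->; rewrite ?fl2K; [left|right|right|left].
Qed.

(* The boundary of a region is an even subgraph, so after contraction it contains
   a cycle of a simple bipartite graph: at least four edges, two flags each. *)
Lemma region_boundary_edges (F B S : {set M}) :
  F \subset inner_edges -> edge_inv F -> edge_inv B ->
  (forall x y, connect (region_rel F) x y) ->
  (forall x, x \in B -> exists a b, [/\ lab x = Some a, lab (fl0 x) = Some b &
                                       (a \in A) = (b \notin A)]) ->
  (forall x y, x \in B -> y \in B -> lab x = lab y -> lab (fl0 x) = lab (fl0 y) ->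
        y = x \/ y = fl2 x) ->
  S != set0 -> S != setT ->
  (forall x y, region_rel (F :|: B) x y -> x \in S -> y \in S) ->
  8 <= #|boundary S :&: B|.
Proof.
move=> Fsub Finv Binv Fconn Blab Buniq /set0Pn[r rS] ST clS.
have S0 x : x \in S -> fl0 x \in S by apply: clS; rewrite /= eqxx.
have S1 x : x \in S -> fl1 x \in S by apply: clS; rewrite /= eqxx orbT.
have S0e x : (fl0 x \in S) = (x \in S).
  by apply/idP/idP => [/S0|/S0//]; rewrite fl0K.
have bdH x : x \in boundary S -> x \notin F -> x \in B.
  rewrite inE => /andP[xS x2S] xF; apply/negPn/negP => xB; case/negP: x2S.
  by apply: clS xS; rewrite /= inE negb_or xF xB eqxx !orbT.
have BF x : x \in B -> x \notin F.
  move=> /Blab[a [b [la lb ab]]]; apply/negP=> /(subsetP Fsub); rewrite inE la lb /=.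
  by case/eqP=> E1; rewrite E1 in ab; case: (b \in A) ab.
set D := boundary S :&: B.
have D0 x : x \in D -> fl0 x \in D.
  by rewrite !inE -fl02C !S0e Binv.1.
(* By [even_boundary] for the branch set of [x], with the flags of [F] left out, the boundary has an
   even number of flags of [B] there, hence a second one. *)
have mate x : x \in D -> exists y, [/\ y \in D, y != x & lab y = lab x].
  move=> xD; have xDl : x \in D :&: [set y | lab y == lab x] by rewrite inE xD inE eqxx.
  have : ~~ odd #|D :&: [set y | lab y == lab x]|.
    have -> : D :&: [set y | lab y == lab x]
            = (boundary S :&: [set y | lab y == lab x]) :\: F.
      apply/setP=> y; rewrite in_setD !in_setI.
      apply/idP/idP => [/andP[/andP[yb yB] yl]|/and3P[yF yb yl]].
        by rewrite BF // yb.
      by rewrite yb yl bdH.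
    apply: even_boundary => // y.
    - by rewrite !inE lab_fl1.
    - by rewrite !inE lab_fl2.
    - by rewrite Finv.1.
    - by move=> yl /(subsetP Fsub); move: yl; rewrite !inE => /eqP<- /andP[_ /eqP<-].
  rewrite (cardsD1 x) xDl /= negbK => odd1.
  have [|[y]] := set_0Vmem ((D :&: [set y | lab y == lab x]) :\ x).
    by move=> E0; rewrite E0 cards0 in odd1.
  by rewrite !in_setD1 in_setI inE => /and3P[yx yD /eqP yl]; exists y.
(* By [Buniq] a mate of [x] with the same far end would be [fl2 x], but the boundary flag [x] has
   [fl2 x] outside [S]. *)
have mate_far x y : x \in D -> y \in D -> y != x -> lab y = lab x ->
    lab (fl0 y) != lab (fl0 x).
  move=> xD yD yx yl; apply/eqP=> yl0.
  have [xB yB] : x \in B /\ y \in B by move: xD yD; rewrite !inE => /andP[_ ->] /andP[_ ->].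
  have [E1|E1] := Buniq x y xB yB (esym yl) (esym yl0); first by rewrite E1 eqxx in yx.
  by move: xD yD; rewrite E1 !inE fl2K => /andP[/andP[xS _] _]; rewrite xS andbF.
(* If the boundary avoided [B], the set [S] would be closed under the single region of [F] and hence
   be everything. *)
have [x xD] : exists x, x \in D.
  apply/set0Pn/negP=> /eqP D0e; case/negP: ST; apply/eqP/setP=> y; rewrite inE.
  have clF : closed (region_rel F) S.
    apply: (intro_closed (region_rel_sym Finv)) => u v /= /or3P[/eqP<-|/eqP<-|].
    - exact: S0.
    - exact: S1.
    case/andP=> uF /eqP<- uS; apply/negPn/negP=> u2S.
    have ub : u \in boundary S by rewrite inE uS u2S.
    by have := in_set0 u; rewrite -D0e inE ub bdH.
  by rewrite -(closed_connect clF (Fconn r y)).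
(* Walk around the boundary: [x] and [y] lie in one branch set, [fl0 u] and [v] in another one on
   the same side of the bipartition. [fl0] carries these four flags to four on the other side. *)
have [y [yD yx ly]] := mate x xD.
have [u [uD ux lu]] := mate _ (D0 _ xD).
have fu := mate_far _ _ (D0 _ xD) uD ux lu; rewrite fl0K in fu.
have [v [vD vu lv]] := mate _ (D0 _ uD).
pose sd z := if lab z is Some l then l \in A else false.
have sd0 z : z \in D -> sd (fl0 z) = ~~ sd z.
  by rewrite inE => /andP[_ /Blab[a [b [la lb ab]]]]; rewrite /sd la lb ab negbK.
have sdl z z' : lab z = lab z' -> sd z = sd z' by rewrite /sd => ->.
have W1 : 4 <= #|[set z in D | sd z == sd x]|.
  have us : uniq [:: x; y; fl0 u; v].
    have n1 : x != fl0 u by apply: contraNneq fu => ->.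
    have n2 : x != v by apply: contraNneq fu => ->; rewrite lv.
    have n3 : y != fl0 u by apply: contraNneq fu => <-; rewrite ly.
    have n4 : y != v by apply: contraNneq fu => yv; rewrite -lv -yv ly.
    by rewrite /= !inE !negb_or [x == y]eq_sym yx n1 n2 n3 n4 [fl0 u == v]eq_sym vu.
  apply: (leq_trans (uniq_leq_size us (s2 := enum [set z in D | sd z == sd x]) _)).
    move=> z; rewrite mem_enum !inE => /or4P[] /eqP->.
    - by rewrite eqxx andbT; move: xD; rewrite !inE.
    - by rewrite (sdl _ _ ly) eqxx andbT; move: yD; rewrite !inE.
    - rewrite sd0 // (sdl _ _ lu) sd0 // negbK eqxx andbT.
      by move: (D0 _ uD); rewrite !inE.
    - rewrite (sdl _ _ lv) sd0 // (sdl _ _ lu) sd0 // negbK eqxx andbT.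
      by move: vD; rewrite !inE.
  by rewrite -cardE.
have W2 : #|[set z in D | sd z == sd x]| <= #|[set z in D | sd z != sd x]|.
  rewrite -(card_imset _ (can_inj (@fl0K M))); apply/subset_leq_card/subsetP=> z.
  case/imsetP=> w; rewrite inE => /andP[wD /eqP ws] ->.
  by rewrite inE D0 // sd0 // ws; case: (sd x).
have := cardsID [set z | sd z == sd x] D.
have -> : D :&: [set z | sd z == sd x] = [set z in D | sd z == sd x].
  by apply/setP=> z; rewrite !inE.
have -> : D :\: [set z | sd z == sd x] = [set z in D | sd z != sd x].
  by apply/setP=> z; rewrite !inE andbC.
lia.
Qed.

(** Euler's inequality bounds the edges of the minor by [#|P| + g - 2] plus the number of regions.
    Either there is one region, or each has at least 8 flags of [B]; regions are disjoint, so there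
    are at most [#|B| / 8] of them. *)
Lemma bipartite_minor_euler (g : nat) :
  (euler_char M = 2 - g%:Z)%R -> E != set0 ->
  #|E| + 4 <= 2 * #|P| + 2 * g \/ #|E| + 1 <= #|P| + g.
Proof.
move=> chi /set0Pn[e0 e0E]; have [x0 [lx0 _]] := E_edge e0E.
have [F [Fsub Finv Fconn Flab]] := contraction_forest.
have [B [Binv cardB Blab Buniq]] := edge_representatives x0.
set H := F :|: B; have Hinv : edge_inv H by apply: edge_invU.
have FB : [disjoint F & B].
  rewrite -setI_eq0; apply/eqP/setP=> x; rewrite in_set0 inE.
  apply/negbTE/negP=> /andP[/(subsetP Fsub)]; rewrite inE => /andP[_ /eqP lx].
  move=> /Blab[a [b [la lb ab]]]; move: lx; rewrite la lb => -[E1].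
  by rewrite E1 in ab; case: (b \in A) ab.
have cardH : #|H| = #|F| + #|B| by rewrite cardsU (disjoint_setI0 FB) cards0 subn0.
have inv0 : edge_inv (set0 : {set M}) by split=> x; rewrite !inE.
have invT : edge_inv (setT : {set M}) by split=> x; rewrite !inE.
have [V1 _] := n_comp_edge_sets inv0 Finv (sub0set _).
have [_ F1] := n_comp_edge_sets Hinv invT (subsetT _).
rewrite setD0 in V1; rewrite setTD in F1.
have EV : n_comp (graph_rel set0) M = n_comp (@vertex_rel M) M.
  apply: eq_n_comp; apply: eq_connect => x y.
  by rewrite /vertex_rel /= inE orbF.
have EF : n_comp (region_rel setT) M = n_comp (@face_rel M) M.
  apply: eq_n_comp; apply: eq_connect => x y.
  by rewrite /face_rel /= inE orbF.
have one (r : rel M) : connect_sym r -> (forall x y, connect r x y) -> n_comp r M <= 1.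
  move=> sym all; rewrite -[X in _ <= X](cards1 tt).
  by apply: (n_comp_le_label (lab := fun=> tt)) => // x _; rewrite inE.
have CT : n_comp (graph_rel setT) M <= 1.
  apply: one; first exact: graph_rel_sym.
  move=> x y; have := map_connected x y; apply: connect_sub => u v /= uv.
  by apply: connect1; rewrite /= inE /= orbA orbC.
(* On the labelled flags [F] has at most [#|P|] components and [H] at least one; on the other flags
   both have the same components. *)
have CH : n_comp (graph_rel F) M + 1 <= n_comp (graph_rel H) M + #|P|.
  pose Q : {pred M} := [pred x | lab x : bool].
  have gFH u v : graph_rel F u v -> graph_rel H u v.
    by move=> /= /or3P[h|h|/andP[h h']]; rewrite ?inE ?h ?h' ?orbT.
  have clH : closed (graph_rel H) Q.
    move=> u v /= /or3P[/eqP<-|/eqP<-|]; rewrite !inE ?lab_fl1 ?lab_fl2 //.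
    case/andP=> /orP[/(subsetP Fsub) ui|/Blab[a [b [la lb _]]]] /eqP<-.
      by move: ui; rewrite inE => /andP[_ /eqP->].
    by rewrite la lb.
  have clF : closed (graph_rel F) Q by move=> u v /gFH /clH.
  have sF := graph_rel_sym Finv; have sH := graph_rel_sym Hinv.
  have out u v : u \notin Q -> graph_rel H u v -> connect (graph_rel F) u v.
    rewrite !inE => uQ /= /or3P[h|h|].
    - by apply: connect1; rewrite /= h.
    - by apply: connect1; rewrite /= h orbT.
    rewrite inE => /andP[/orP[h h'|]]; first by apply: connect1; rewrite /= h h' !orbT.
    by move=> /Blab[a [b [la _ _]]]; rewrite la in uQ.
  have := n_comp_exchange clF clH (fun u v _ uv => connect1 (gFH u v uv)) out.
  have : n_comp (graph_rel F) Q <= #|P|.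
    apply: leq_trans (leq_imset_card some P).
    apply: (n_comp_le_label (lab := lab)) => // [x|x y lx _]; last exact: Flab.
    rewrite inE; case lx: (lab x) => [l|] // _; apply/imsetP; exists l => //.
    exact: lab_in lx.
  have : 0 < n_comp (graph_rel H) Q.
    by apply: (@n_comp_gt0 _ _ _ x0) => //; rewrite inE lx0.
  by lia.
have cardC : #|~: H| + #|H| = #|M| by rewrite addnC cardsC.
(* [V1] goes from no edges to [F], and [F1] from [H] to all edges of the map. In the sum only the
   flags of [B] are left over from the total count [cf]. *)
have key : #|B| + 8 <= 4 * n_comp (region_rel H) M + 4 * g + 4 * #|P|.
  have cf := card_flags_le M; rewrite /euler_char in chi.
  rewrite EV in V1; rewrite EF in F1.
  move: (n_comp (@vertex_rel M) M) (n_comp (@face_rel M) M) (n_comp (@edge_cell_rel M) M)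
    V1 F1 CT CH cardC chi cf => nV nF nE.
  lia.
have [f1|f2] := leqP (n_comp (region_rel H) M) 1; first by right; lia.
left; suff : 8 * n_comp (region_rel H) M <= #|B| by lia.
have sR := region_rel_sym Hinv.
pose rt := fingraph.root (region_rel H).
rewrite -[X in _ <= X]sum1_card (partition_big rt (roots (region_rel H))) => /=; last first.
  by move=> x _; apply: roots_root sR _.
have -> : n_comp (region_rel H) M = \sum_(r | roots (region_rel H) r) 1.
  by rewrite sum1_card; apply: eq_card => x; rewrite !inE andbT.
rewrite big_distrr /=; apply: leq_sum => r /eqP rr; rewrite muln1 sum1_card.
pose S := [set y | connect (region_rel H) r y].
have : 8 <= #|boundary S :&: B|.
  apply: (@region_boundary_edges F) => //.
  - by apply/set0Pn; exists r; rewrite inE connect0.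
  - apply: contraTneq f2 => ST; rewrite -leqNgt; apply: one => // x y.
    have xS : x \in S by rewrite ST inE.
    have yS : y \in S by rewrite ST inE.
    by move: xS yS; rewrite !inE sR; apply: connect_trans.
  - by move=> x y xy; rewrite !inE => /connect_trans; apply; apply: connect1.
move=> h; apply: leq_trans h _; apply/subset_leq_card/subsetP=> x.
rewrite !inE => /andP[/andP[rx _] xB]; rewrite unfold_in /= xB /rt.
by move/(fingraph.rootP sR): rx => <-; rewrite rr eqxx.
Qed.
End BipartiteMinor.

(** * Components of vertex-deleted subgraphs *)

Section Graphs.
Variable G : sgraph.
Implicit Types (A X : {set G}) (a u v w x y : G).

Definition minus_rel A u v := [&& u \notin A, v \notin A & adj u v].
Arguments minus_rel A u v /.

(* One representative for each component of [G - A]. *)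
Definition parts A : {set G} :=
  [set x | (x \notin A) && (fingraph.root (minus_rel A) x == x)].

Definition attachments A x : {set G} :=
  [set a in A | [exists u, connect (minus_rel A) x u && adj a u]].

Definition part_degree A a := #|[set x in parts A | a \in attachments A x]|.

Definition link_rel A u v := adj u v && ~~ ((u \in A) && (v \in A)).
Arguments link_rel A u v /.
Definition linked A := forall x y, connect (link_rel A) x y.

Lemma minus_rel_sym A : connect_sym (minus_rel A).
Proof. by apply: sym_connect_sym => x y /=; rewrite adj_sym andbCA. Qed.

Lemma minus_rel_closed A : closed (minus_rel A) A.
Proof. by move=> x y /and3P[/negbTE-> /negbTE->]. Qed.

Lemma minus_rel_removed A a x : a \in A -> connect (minus_rel A) a x -> x = a.
Proof. by move=> aA /connectP[[|y p] /= +]; rewrite ?aA // => _ ->. Qed.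

Lemma root_part A x : x \notin A -> fingraph.root (minus_rel A) x \in parts A.
Proof.
move=> xA; have sym := minus_rel_sym A; rewrite inE (fingraph.root_root sym) eqxx andbT.
by rewrite -(closed_connect (@minus_rel_closed A) (connect_root _ x)).
Qed.

Lemma part_root A x : x \in parts A -> fingraph.root (minus_rel A) x = x.
Proof. by rewrite inE => /andP[_ /eqP]. Qed.

Lemma part_notin A x : x \in parts A -> x \notin A.
Proof. by rewrite inE => /andP[]. Qed.

Lemma connect_attachments A x y :
  connect (minus_rel A) x y -> attachments A x = attachments A y.
Proof.
move=> xy; apply/setP=> a; rewrite !inE; congr (_ && _).
by apply: eq_existsb => u; rewrite (same_connect (@minus_rel_sym A) xy).
Qed.

(** The attachments of a component separate it from every other vertex outside [A], so fewer than
    [r] of them would contradict [r]-connectivity. *)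
Lemma card_attachments_ge r A x y : r_connected r G ->
  x \notin A -> y \notin A -> ~~ connect (minus_rel A) x y ->
  r <= #|attachments A x|.
Proof.
move=> [_ Gr] xA yA nxy; rewrite leqNgt; apply/negP=> lt.
have sub : attachments A x \subset A by apply/subsetP=> a; rewrite inE => /andP[].
have nA z : z \notin A -> z \notin attachments A x.
  by apply: contra; apply: (subsetP sub).
have := Gr _ lt x y (nA _ xA) (nA _ yA); set e := (X in connect X).
have sym : connect_sym e.
  by apply: sym_connect_sym => u v; rewrite /e /= adj_sym andbCA.
have cl : closed e (connect (minus_rel A) x).
  apply: (intro_closed sym) => u v; rewrite /e /= !inE => /and3P[_ vn uv] xu.
  have uA : u \notin A by rewrite -(closed_connect (@minus_rel_closed A) xu).
  apply: (connect_trans xu); apply: connect1; rewrite /= uA uv andbT.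
  apply: contra vn => vA; rewrite vA; apply/existsP; exists u.
  by rewrite xu adj_sym uv.
by move/(closed_connect cl); rewrite !inE connect0 (negbTE nxy).
Qed.

Lemma sum_part_degree A :
  \sum_(x in parts A) #|attachments A x| = \sum_(a in A) part_degree A a.
Proof.
under eq_bigr => x _ do rewrite -sum1_card.
under [RHS]eq_bigr => a _ do rewrite /part_degree -sum1_card.
rewrite (exchange_big_dep (mem A)) /=; last by move=> x a _; rewrite inE => /andP[].
by apply: eq_bigr => a aA; apply: eq_bigl => x; rewrite [RHS]inE.
Qed.

(** Each vertex of [A] is a class of its own for [minus_rel A]. *)
Lemma n_comp_minus_rel A : n_comp (minus_rel A) G = #|A| + #|parts A|.
Proof.
rewrite -cardsUI; have -> : A :&: parts A = set0.
  by apply/setP=> x; rewrite !inE; case: (x \in A).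
rewrite cards0 addn0; apply: eq_card => x; rewrite !inE andbT.
case xA: (x \in A) => //=; apply/eqP.
by apply: (minus_rel_removed xA); apply: connect_root.
Qed.

(** Only the new class of [v] changes: it absorbs the singleton [v] and all components that [v]
    sees. *)
Lemma card_parts_put_back A v : v \in A ->
  #|parts (A :\ v)| + part_degree A v <= #|parts A| + 1.
Proof.
move=> vA; pose e := minus_rel A; pose e' := minus_rel (A :\ v).
have sym := @minus_rel_sym A; have sym' := @minus_rel_sym (A :\ v).
have sub u w : e u w -> e' u w.
  by rewrite /e /e' /= !inE !negb_and => /and3P[->->->]; rewrite !orbT.
pose P : {pred G} := connect e' v.
have cl' : closed e' P by apply: connect_closed.
have cl : closed e P by move=> u w /sub/cl'.
have out u w : u \notin P -> e' u w -> connect e u w.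
  move=> uP uw; have wP : w \notin P by rewrite -(cl' _ _ uw).
  have nv z : z \notin P -> z != v by apply: contraNneq => ->; apply: connect0.
  apply: connect1; move: uw; rewrite /e /e' /= !inE !negb_and !negbK.
  by rewrite (negbTE (nv _ uP)) (negbTE (nv _ wP)).
have := n_comp_exchange cl cl' (fun u w _ uw => connect1 (sub u w uw)) out.
rewrite !n_comp_minus_rel (n_comp_connect sym') (cardsD1 v A) vA.
suff : (part_degree A v).+1 <= n_comp e P by rewrite /e; lia.
have vD : v \notin [set x in parts A | v \in attachments A x] by rewrite !inE vA.
rewrite /part_degree; apply: (@leq_trans #|v |: [set x in parts A | v \in attachments A x]|).
  by rewrite cardsU1 vD.
apply/subset_leq_card/subsetP=> x; rewrite in_setU1 => /orP[/eqP->|].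
  apply/andP; split; last exact: connect0.
  by apply/eqP/(minus_rel_removed vA); apply: connect_root.
rewrite inE => /andP[xp]; rewrite inE => /andP[_ /existsP[u /andP[xu vu]]].
apply/andP; split; first exact/eqP/part_root.
have uA : u \notin A.
  by rewrite -(closed_connect (@minus_rel_closed A) xu) part_notin.
apply: (@connect_trans _ _ u).
  by apply: connect1; rewrite /e' /= !inE eqxx vu (negbTE uA) andbF.
by move: xu; rewrite sym; apply: connect_sub => ? ? /sub; apply: connect1.
Qed.

Lemma linkedS A X : X \subset A -> linked A -> linked X.
Proof.
move=> sXA lA x y; apply: connect_sub (lA x y) => u v /= /andP[uv nA].
apply: connect1; rewrite /= uv; apply: contra nA.
by case/andP=> /(subsetP sXA)-> /(subsetP sXA)->.
Qed.

Lemma linked_dominated A a : 1 < #|G| -> linked A -> a \in A ->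
  exists2 u, u \notin A & adj a u.
Proof.
move=> G1 lA aA; have [y ya] : exists y, y != a.
  have : 0 < #|predC1 a| by rewrite cardC1; lia.
  by case/card_gt0P=> y; exists y.
have /connectP[[|u p] /=] := lA a y; first by move=> _ E; rewrite E eqxx in ya.
by case/andP=> /andP[au]; rewrite aA /= => uA _ _; exists u.
Qed.

(** If every vertex of [A] saw at most one component, the component of [x] with its attachments
    would be closed under [link_rel A], as no edge inside [A] leads out of it. *)
Lemma linked_merging_vertex A x y : linked A -> x \notin A -> y \notin A ->
  ~~ connect (minus_rel A) x y -> exists2 a, a \in A & 2 <= part_degree A a.
Proof.
move=> lA xA yA nxy; have sym := @minus_rel_sym A.
suff /exists_inP[a aA d] : [exists a in A, 2 <= part_degree A a] by exists a.
have [//|] := boolP [exists a in A, 2 <= part_degree A a].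
rewrite negb_exists => /forallP deg; exfalso.
have deg1 a : a \in A -> part_degree A a <= 1.
  by move=> aA; have := deg a; rewrite aA -leqNgt.
pose C := [set u | if u \in A then u \in attachments A x else connect (minus_rel A) x u].
have symL : connect_sym (link_rel A).
  by apply: sym_connect_sym => u v /=; rewrite adj_sym andbC [(u \in A) && _]andbC andbC.
have cl : closed (link_rel A) C.
  apply: (intro_closed symL) => u w /= /andP[uw]; rewrite !inE.
  case uA: (u \in A); case wA: (w \in A) => //= _.
  - case/existsP=> v /andP[xv uv].
    pose x' := fingraph.root (minus_rel A) x; pose w' := fingraph.root (minus_rel A) w.
    have := deg1 u uA => /card_le1P /(_ x').
    have at_root z t : connect (minus_rel A) z t -> adj u t ->
        u \in attachments A (fingraph.root (minus_rel A) z).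
      move=> zt ut; rewrite -(connect_attachments (connect_root _ z)) inE uA.
      by apply/existsP; exists t; rewrite zt.
    rewrite inE root_part //= (at_root _ _ xv) // => /(_ isT w').
    rewrite inE root_part ?wA //= (at_root w w) ?connect0 // !inE => /esym /eqP E.
    by apply/(fingraph.rootP sym); rewrite -/x' -E.
  - by move=> xu; apply/existsP; exists u; rewrite xu adj_sym.
  - by move=> xu; apply: connect_trans xu (connect1 _); rewrite /= uA wA.
have := closed_connect cl (lA x y); rewrite !inE (negbTE xA) (negbTE yA) connect0.
by rewrite (negbTE nxy).
Qed.

(** If the edges across a maximum cut [X] do not connect [G], flipping [X] on one of their
    components keeps every cut edge and gains the edges of [G] that leave this component. *)
Lemma max_cut_connected : (forall x y : G, connect adj x y) ->
  exists X : {set G}, forall x y,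
    connect (fun u v => adj u v && ((u \in X) != (v \in X))) x y.
Proof.
move=> Gc; pose cut (X : {set G}) := [set p : G * G | adj p.1 p.2 & (p.1 \in X) != (p.2 \in X)].
case: (@arg_maxnP _ (set0 : {set G}) xpredT (fun X => #|cut X|)) => // X _ Xmax.
exists X => x y; set e := (X in connect X); apply/negPn/negP=> nxy.
have sym : connect_sym e.
  by apply: sym_connect_sym => u v; rewrite /e adj_sym eq_sym.
have acl u v : e u v -> (u \in connect e x) = (v \in connect e x).
  exact: (connect_closed sym).
pose Y := [set u | (u \in X) (+) (u \in connect e x)].
have subY : cut X \subset cut Y.
  apply/subsetP=> -[u v]; rewrite !inE /= => /andP[uv ne]; rewrite uv /=.
  have /acl : e u v by rewrite /e uv.
  rewrite !inE => ->; apply: contraNN ne.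
  by case: (u \in X); case: (v \in X); case: (connect e x v).
have [u [v [uv uC vC]]] : exists u v, [/\ adj u v, u \in connect e x & v \notin connect e x].
  case: (boolP [exists u, exists v, [&& adj u v, u \in connect e x & v \notin connect e x]]).
    by case/existsP=> u /existsP[v /and3P[]]; exists u, v.
  rewrite negb_exists => /forallP h; case/negP: nxy.
  have cl : closed (@adj G) (connect e x).
    apply: (intro_closed (sym_connect_sym (@adj_sym G))) => u v uv uC.
    have := h u; rewrite negb_exists => /forallP/(_ v); rewrite uv uC /=.
    by rewrite negbK.
  by have := closed_connect cl (Gc x y); rewrite !inE connect0.
suff : #|cut X| < #|cut Y| by rewrite ltnNge => /negP[]; apply: Xmax Y isT.
apply: proper_card.
apply/properP; split=> //; exists (u, v); rewrite inE /= uv /=.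
  rewrite !inE in uC vC *; rewrite uC (negbTE vC).
  have : ~~ e u v by apply/negP=> /acl; rewrite !inE uC (negbTE vC).
  by rewrite /e uv /= negbK => /eqP->; case: (v \in X).
by rewrite negbK; apply: contraNT vC => ne; rewrite -(acl u v) // /e uv.
Qed.

(** Contract the components of [G - A] and join each to its attachments, of which there are at least
    [r]. Vertices of the map outside [G] get no label. *)
Lemma parts_euler (g r : nat) (M : surface_map) A :
  (euler_char M = 2 - g%:Z)%R -> in_skeleton G M -> r_connected r G ->
  2 < r -> 1 < #|parts A| ->
  r * #|parts A| + 4 <= 2 * (#|A| + #|parts A|) + 2 * g.
Proof.
move=> chi [f [finj fadj]] Gr r2 k2.
have symV : connect_sym (@vertex_rel M).
  apply: sym_connect_sym => x y; rewrite /vertex_rel /=.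
  by rewrite (involution_eq_sym x y (@fl1K M)) (involution_eq_sym x y (@fl2K M)).
have symA := @minus_rel_sym A.
(* A branch set is named by the representative of its component, which for a vertex of [A] is the
   vertex itself. *)
pose lab (d : M) := omap (fingraph.root (minus_rel A)) [pick v | same_vertex (f v) d].
have labP v d : same_vertex (f v) d -> lab d = Some (fingraph.root (minus_rel A) v).
  move=> vd; rewrite /lab; case: pickP => [w wd|/(_ v)]; last by rewrite vd.
  congr Some; congr fingraph.root; apply: finj; rewrite /same_vertex symV in vd.
  exact: connect_trans wd vd.
have labE d l : lab d = Some l ->
    exists2 v, same_vertex (f v) d & l = fingraph.root (minus_rel A) v.
  by rewrite /lab; case: pickP => // v vd [<-]; exists v.
have same_lab d d' : @vertex_rel M d d' -> lab d' = lab d.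
  move=> dd'; rewrite /lab; congr omap; apply: eq_pick => v.
  by rewrite /= /same_vertex (same_connect1r symV dd').
have lab1 d : lab (fl1 d) = lab d by apply: same_lab; rewrite /vertex_rel /= eqxx.
have lab2 d : lab (fl2 d) = lab d by apply: same_lab; rewrite /vertex_rel /= eqxx orbT.
pose E := [set p : G * G | (p.1 \in parts A) && (p.2 \in attachments A p.1)].
have cardE : r * #|parts A| <= #|E|.
  have -> : #|E| = \sum_(x in parts A) #|attachments A x|.
    under [RHS]eq_bigr => x _ do rewrite -sum1_card.
    by rewrite pair_big_dep /= -sum1_card; apply: eq_bigl => p; rewrite inE.
  rewrite -sum1_card big_distrr /=; apply: leq_sum => x xp; rewrite muln1.
  have [y] : exists y, y \in parts A :\ x.
    by apply/card_gt0P; move: k2; rewrite (cardsD1 x) xp.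
  rewrite in_setD1 => /andP[yx yp].
  apply: (card_attachments_ge Gr (part_notin xp) (part_notin yp)).
  by rewrite -(fingraph.root_connect symA) (part_root xp) (part_root yp) eq_sym.
have := @bipartite_minor_euler M G lab (A :|: parts A) (~: A) E lab1 lab2 _ _ _ _ g chi.
have -> : #|A :|: parts A| = #|A| + #|parts A|.
  rewrite cardsU; have -> : A :&: parts A = set0.
    by apply/setP=> x; rewrite !inE; case: (x \in A).
  by rewrite cards0 subn0.
have E0 : E != set0 by rewrite -card_gt0; move: cardE; nia.
move=> euler; have {euler} : #|E| + 4 <= 2 * (#|A| + #|parts A|) + 2 * g \/
    #|E| + 1 <= #|A| + #|parts A| + g.
  apply: euler => //.
  - move=> d l /labE[v _ ->]; rewrite inE; case: (boolP (v \in A)) => [vA|/root_part->].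
      by rewrite (minus_rel_removed vA (connect_root _ _)) vA.
    by rewrite orbT.
  - move=> d d'; case E1: (lab d) => [l|] // _ /esym E2.
    have [v vd lv] := labE _ _ E1; have [v' vd' lv'] := labE _ _ E2.
    have gv (s t : M) : same_vertex s t -> connect (graph_rel (inner_edges lab)) s t.
      rewrite /same_vertex; apply: connect_sub => {}s {}t.
      rewrite /vertex_rel /= => /orP[]h; apply: connect1; by rewrite /= h ?orbT.
    have vv' : connect (minus_rel A) v v'.
      by apply/(fingraph.rootP symA); rewrite -lv -lv'.
    have fvv' : connect (graph_rel (inner_edges lab)) (f v) (f v').
      case/connectP: vv' => p; elim: p {vd lv} v => [|w p IH] v /=.
        by move=> _ ->; apply: connect0.
      case/andP=> vw pw lw; apply: connect_trans (IH w pw lw).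
      have [_ _ avw] := and3P vw; have [s [vs ws]] := fadj _ _ avw.
      apply: connect_trans (gv _ _ vs) _; apply: (@connect_trans _ _ (fl0 s)).
        apply: connect1; rewrite /= inE (labP _ _ vs) (labP _ _ ws) /=.
        have /(fingraph.rootP symA) -> : connect (minus_rel A) v w by apply: connect1.
        by rewrite !eqxx !orbT.
      by apply: gv; rewrite /same_vertex symV.
    apply: connect_trans (connect_trans fvv' (gv _ _ vd')).
    by apply: gv; rewrite /same_vertex symV.
  - by move=> [x a] /=; rewrite !inE /= negbK => /andP[/andP[-> _] /andP[]].
  - move=> [x a]; rewrite inE /= => /andP[xp]; rewrite inE => /andP[aA].
    case/existsP=> u /andP[xu au].
    have [d [ad ud]] := fadj _ _ au.
    exists (fl0 d); rewrite fl0K (labP _ _ ud) (labP _ _ ad).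
    rewrite (minus_rel_removed aA (connect_root _ _)); split=> //.
    by rewrite -(part_root xp); congr Some; apply/esym/(fingraph.rootP symA).
(* The second alternative, doubled, is at least as strong because [r * #|parts A|] is at least 2. *)
by case; nia.
Qed.
End Graphs.

Arguments minus_rel {G} A u v /.
Arguments link_rel {G} A u v /.

(** * Spanning trees with prescribed leaves *)

Section LeafTree.
Variables (G : sgraph) (A : {set G}).
Hypothesis G_minus_A : forall x y, x \notin A -> y \notin A -> connect (minus_rel A) x y.
Hypothesis A_dominated : forall a, a \in A -> exists2 u, u \notin A & adj a u.

Lemma edge_rel_sym (F : {set {set G}}) : connect_sym (edge_rel F).
Proof. by apply: sym_connect_sym => x y; rewrite /edge_rel /= setUC. Qed.

(** The rest of a cycle through the edge [[set x; y]] still joins [x] and [y] once this edge is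
    removed, so the edge could be spared. *)
Lemma minimal_connected_acyclic (F : {set {set G}}) :
  (forall x y, connect (edge_rel F) x y) ->
  (forall f, f \in F -> exists x y, ~~ connect (edge_rel (F :\ f)) x y) ->
  forall c : seq G, ucycle (edge_rel F) c -> size c < 3.
Proof.
move=> Fc Fmin [|x [|y [|z s]]] // /andP[] /= /and3P[xy yz pz].
rewrite !inE !negb_or => /and3P[/and3P[nxy nxz xs] /andP[nyz ys] _].
set F' := F :\ [set x; y].
have inF' p q : [set p; q] \in F -> p != x -> p != y -> edge_rel F' p q.
  move=> pq px py; rewrite /edge_rel /= !inE pq andbT; apply/eqP=> E.
  by move/setP/(_ p): E; rewrite !inE eqxx (negbTE px) (negbTE py).
have long t w : path (edge_rel F) w (rcons t x) -> w != x -> w != y ->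
    x \notin t -> y \notin t -> connect (edge_rel F') w x.
  elim: t w => [|v t IH] w /= /andP[wv pv] wx wy.
    by move=> _ _; apply: connect1; apply: inF'.
  rewrite !inE !negb_or => /andP[xv xt] /andP[yv yt].
  apply: (connect_trans (connect1 (inF' _ _ wv wx wy))).
  by apply: IH; rewrite // eq_sym.
have zx : connect (edge_rel F') z x by apply: (long s); rewrite // eq_sym.
have yx : connect (edge_rel F') y x.
  apply: connect_trans zx; rewrite edge_rel_sym; apply: connect1.
  by apply: inF'; rewrite ?[z == _]eq_sym //; move: yz; rewrite /edge_rel /= setUC.
have [u [v]] := Fmin _ xy; case/negP; have := Fc u v; apply: connect_sub => {u v} u v uv.
have [E|ne] := eqVneq [set u; v] [set x; y]; last first.
  by apply: connect1; rewrite /edge_rel /= in_setD1 ne.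
have xy' : connect (edge_rel F') x y by rewrite edge_rel_sym.
have uE : u \in [set x; y] by rewrite -E !inE eqxx.
have vE : v \in [set x; y] by rewrite -E !inE eqxx orbT.
by move: uE vE; rewrite !inE => /orP[]/eqP-> /orP[]/eqP->.
Qed.

(** Start from the edges of [G - A] and a single edge from each [a] in [A] to a neighbour [p a]
    outside [A]. A minimal connected subset is a tree, in which [a] can only have the edge to
    [p a]. *)
Lemma spanning_tree_with_leaves :
  exists2 F, F \in spanning_trees G & A \subset leaves F.
Proof.
have [p pP] : exists p : G -> G, forall a, a \in A -> p a \notin A /\ adj a (p a).
  apply: (@fin_all_exists _ (fun=> G : Type) (fun a u => a \in A -> u \notin A /\ adj a u)) => a.
  by have [/A_dominated[u]|] := boolP (a \in A); [exists u | exists a].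
pose E0 : {set {set G}} :=
  [set [set q.1; q.2] | q : G * G & minus_rel A q.1 q.2] :|: [set [set a; p a] | a in A].
have E0c x y : connect (edge_rel E0) x y.
  have out u v : u \notin A -> v \notin A -> connect (edge_rel E0) u v.
    move=> uA vA; apply: connect_sub (G_minus_A uA vA) => s t st; apply: connect1.
    by rewrite /edge_rel /= inE; apply/orP; left; apply/imsetP; exists (s, t); rewrite ?inE.
  have toout u : exists2 v, v \notin A & connect (edge_rel E0) u v.
    have [uA|uA] := boolP (u \in A); last by exists u.
    exists (p u); first by case: (pP u uA).
    by apply: connect1; rewrite /edge_rel /= inE; apply/orP; right; apply/imsetP; exists u.
  have [x' x'A xx'] := toout x; have [y' y'A yy'] := toout y.
  apply: (connect_trans xx'); apply: (connect_trans (out _ _ x'A y'A)).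
  by rewrite edge_rel_sym.
pose ok (F : {set {set G}}) := [forall x, forall y, connect (edge_rel F) x y].
have okE0 : ok E0 by apply/forallP=> x; apply/forallP=> y.
have [F minF FE0] := minset_exists okE0.
have [okF Fmin] := minsetP minF.
have Fc x y : connect (edge_rel F) x y by move/forallP: okF => /(_ x)/forallP.
exists F.
  rewrite inE; apply/asboolP; split=> //.
    apply: (subset_trans FE0); apply/subsetP=> f; rewrite inE => /orP[] /imsetP[].
      by move=> q; rewrite inE => /and3P[_ _ qa] ->; apply/imsetP; exists q; rewrite ?inE.
    by move=> a /pP[_ ap] ->; apply/imsetP; exists (a, p a); rewrite ?inE.
  apply: minimal_connected_acyclic => // f fF.
  have [okf|] := boolP (ok (F :\ f)).
    have := Fmin _ okf (subsetDl _ _) => E; move: fF; rewrite -E.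
    by rewrite !inE eqxx.
  by rewrite negb_forall => /existsP[x]; rewrite negb_forall => /existsP[y]; exists x, y.
apply/subsetP=> a aA; rewrite inE; have [pA ap] := pP a aA.
have E1 f : f \in F -> a \in f -> f = [set a; p a].
  move/(subsetP FE0); rewrite inE => /orP[] /imsetP[].
    move=> [u v]; rewrite inE /= => /and3P[uA vA _] ->; rewrite !inE.
    by case/orP=> /eqP E; rewrite -E aA in uA vA.
  move=> b bA -> ; rewrite !inE => /orP[/eqP->//|/eqP E].
  by have [] := pP b bA; rewrite -E aA.
have -> : [set f in F | a \in f] = [set [set a; p a]]; last by rewrite cards1.
apply/setP=> f; rewrite !inE; apply/andP/eqP => [[fF af]|->]; first exact: E1.
rewrite !inE eqxx; split=> //.
have /connectP[[|u q] /=] := Fc a (p a).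
  by move=> _ E; rewrite E aA in pA.
case/andP=> au _ _; have <- : [set a; u] = [set a; p a]; last exact: au.
by apply: E1 => //; rewrite !inE eqxx.
Qed.
End LeafTree.

(** * The greedy procedure *)

Local Open Scope ring_scope.

Section Potential.
Variables (R : realFieldType) (r : nat).
Hypothesis r_gt2 : (2 < r)%N.

(* [potential n z k] bounds from below the number of vertices still removed at
   the end of the greedy procedure, from a state with [z] removed vertices and
   [k] components; it is constant along steps that merge [n.+2] components. *)
Definition density n : R := \prod_(i < n) (1 - (r.-1%:R * i.+1%:R)^-1).
Definition potential n (z k : R) := density n / n.+1%:R * (n.+1%:R * z - k).

Lemma density_factor i :
  (2%:R)^-1 <= 1 - (r.-1%:R * i.+1%:R : R)^-1 <= 1.
Proof.
have h : 2%:R <= (r.-1%:R * i.+1%:R : R) by rewrite -natrM ler_nat; nia.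
have h0 : 0 < (r.-1%:R * i.+1%:R : R) by apply: lt_le_trans h; rewrite ltr0n.
have := h; rewrite -lef_pV2 ?posrE ?ltr0n // => h1.
have h2 : 0 < (r.-1%:R * i.+1%:R : R)^-1 by rewrite invr_gt0.
by move: (_^-1) h1 h2 => y h1 h2; apply/andP; split; lra.
Qed.

Lemma density_bounds n : 0 < density n <= 1.
Proof.
elim: n => [|n]; rewrite /density ?big_ord0 ?ltr01 ?lexx // big_ord_recr /=.
rewrite -/(density n); have := density_factor n.
set x := 1 - _ => /andP[x2 x1] /andP[d0 d1]; apply/andP; split; last by nra.
by apply: mulr_gt0 => //; lra.
Qed.

(** The factors of [density] are chosen so that consecutive potentials agree exactly where
    [r k = (n + 2) z], that is, where the guaranteed degree [r k / z] equals [n + 2]. *)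
Lemma potential_step n (z k : R) : r%:R * k <= n.+2%:R * z ->
  potential n.+1 z k <= potential n z k.
Proof.
move=> h; rewrite /potential /density big_ord_recr /= -/(density n).
have /andP[d0 _] := density_bounds n.
rewrite -!mulrA ler_pM2l //.
have m0 : (0 : R) < r.-1%:R by rewrite ltr0n; lia.
have E : (r%:R : R) = r.-1%:R + 1 by rewrite natr1; congr (_%:R); lia.
rewrite E in h; move: (r.-1%:R : R) m0 h => m m0 h.
have n0 : (0 : R) <= n%:R by rewrite ler0n.
rewrite -!natr1 in h *; move: (n%:R : R) n0 h => x x0 h.
rewrite -subr_ge0.
have -> : (x + 1)^-1 * ((x + 1) * z - k) -
  (1 - (m * (x + 1))^-1) * ((x + 1 + 1)^-1 * ((x + 1 + 1) * z - k)) =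
  ((x + 1 + 1) * z - (m + 1) * k) / (m * (x + 1) * (x + 1 + 1)).
  by field; rewrite ?lt0r_neq0 //; lra.
apply: divr_ge0; first lra.
by apply: mulr_ge0; [apply: mulr_ge0|]; lra.
Qed.

Lemma potential_mono d n (z k : R) : (d <= n)%N -> 0 <= z ->
  r%:R * k <= d.+2%:R * z -> potential n z k <= potential d z k.
Proof.
move=> dn z0 h; elim: n dn => [|n IH]; first by rewrite leqn0 => /eqP->.
rewrite leq_eqVlt => /orP[/eqP->//|]; rewrite ltnS => dn.
apply: le_trans (IH dn); apply: potential_step; apply: le_trans h _.
by apply: ler_wpM2r => //; rewrite ler_nat !ltnS.
Qed.

Lemma potential_le n (z k : R) : 0 <= z -> 0 <= k -> potential n z k <= z.
Proof.
move=> z0 k0; have /andP[d0 d1] := density_bounds n.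
have c0 : 0 <= density n / n.+1%:R by rewrite divr_ge0 ?ler0n // ltW.
apply: (@le_trans _ _ (density n * z)); last by nra.
have -> : density n * z = density n / n.+1%:R * (n.+1%:R * z).
  by rewrite mulrA divfK // pnatr_eq0.
by apply: ler_wpM2l => //; lra.
Qed.

Lemma potential_homo n (z k z' k' : R) :
  n.+1%:R * z - k <= n.+1%:R * z' - k' -> potential n z k <= potential n z' k'.
Proof.
move=> h; apply: ler_wpM2l => //; have /andP[d0 _] := density_bounds n.
by rewrite divr_ge0 ?ler0n // ltW.
Qed.

Lemma bernoulli_lower (y : R) m : 0 <= y <= 1 -> 1 - m%:R * y <= (1 - y) ^+ m.
Proof.
move=> /andP[y0 y1]; elim: m => [|m IH]; first by rewrite expr0; lra.
rewrite exprS -natr1; have m0 : (0 : R) <= m%:R by rewrite ler0n.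
apply: (@le_trans _ _ ((1 - y) * (1 - m%:R * y))); first by nra.
by apply: ler_wpM2l IH; lra.
Qed.

(** The first factor is at least 1/2, which the 2 compensates. By Bernoulli, the power [r.-1] of the
    factor with index [i >= 1] is at least [i / (i + 1)], and these telescope. *)
Lemma density_lower n :
  1 <= (2 * density n.+1) ^+ r.-1 * n.+1%:R.
Proof.
elim: n => [|n IH].
  rewrite mulr1 /density big_ord_recr big_ord0 /= mul1r; apply: exprn_ege1.
  by have /andP[h _] := density_factor 0; lra.
rewrite /density big_ord_recr /= -/(density n.+1) mulrA exprMn.
have n1 : (0 : R) < n.+1%:R by rewrite ltr0n.
have m0 : (0 : R) < r.-1%:R by rewrite ltr0n; lia.
set X := (2 * density n.+1) ^+ r.-1 in IH *.
have X0 : 0 <= X.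
  by apply: exprn_ge0; have /andP[d0 _] := density_bounds n.+1; lra.
apply: (le_trans IH); rewrite -mulrA; apply: ler_wpM2l => //.
have y01 : 0 <= (r.-1%:R * n.+2%:R : R)^-1 <= 1.
  have := density_factor n.+1; move: (_ * _)^-1 => y /andP[h1 h2].
  by apply/andP; split; lra.
have := bernoulli_lower r.-1 y01.
have -> : r.-1%:R * (r.-1%:R * n.+2%:R)^-1 = (n.+2%:R : R)^-1.
  by rewrite invfM mulrA divff ?mul1r // lt0r_neq0.
move=> b; apply: (@le_trans _ _ ((1 - n.+2%:R^-1) * n.+2%:R)); last first.
  by apply: ler_wpM2r => //; rewrite ler0n.
by rewrite mulrBl mul1r mulVf ?pnatr_eq0 // -[n.+2%:R]natr1; lra.
Qed.
End Potential.

Section Greedy.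
Variables (R : realFieldType) (G : sgraph) (r : nat).
Hypotheses (r_gt2 : (2 < r)%N) (Gr : r_connected r G).
Implicit Types (A X K : {set G}).

Definition nonseparating X :=
  forall x y, x \notin X -> y \notin X -> connect (minus_rel X) x y.

Lemma few_parts_nonseparating A : (#|parts A| <= 1)%N -> nonseparating A.
Proof.
move=> /card_le1P k1 x y xA yA; apply/(fingraph.rootP (@minus_rel_sym G A)).
by have := k1 _ (root_part xA) (fingraph.root (minus_rel A) y);
  rewrite root_part // inE => /esym/eqP.
Qed.

(** Induction on [#|A|] for all [n] at once, since the index of the potential may change at each
    step. *)
Lemma greedy_nonseparating A n : linked A ->
  exists X, [/\ X \subset A, nonseparating X &
    potential r n (#|A|%:R : R) #|parts A|%:R <= #|X|%:R].
Proof.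
have [s] := ubnP #|A|; elim: s A n => // s IH A n le_s lA.
have [k1|k2] := leqP #|parts A| 1.
  exists A; split=> //; first exact: few_parts_nonseparating.
  by apply: potential_le; rewrite ?ler0n.
have many x : x \in parts A -> exists2 y, y \notin A & ~~ connect (minus_rel A) x y.
  move=> xp; have [y] : exists y, y \in parts A :\ x.
    by apply/card_gt0P; move: k2; rewrite (cardsD1 x) xp.
  rewrite in_setD1 => /andP[yx yp]; exists y; first exact: part_notin.
  by rewrite -(fingraph.root_connect (@minus_rel_sym G A)) !part_root // eq_sym.
have [x xp] : exists x, x \in parts A by apply/card_gt0P; lia.
have [y yA nxy] := many x xp.
have [a aA da] := linked_merging_vertex lA (part_notin xp) yA nxy.
case: (@arg_maxnP _ a (mem A) (part_degree A)) => // v vA' vmax.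
have vA : v \in A := vA'.
have d2 : (2 <= part_degree A v)%N by apply: leq_trans da (vmax a aA).
(* The maximum degree is at least the average, and each component contributes at least [r]
   attachments to the total. *)
have rk : (r * #|parts A| <= #|A| * part_degree A v)%N.
  apply: (@leq_trans (\sum_(x in parts A) #|attachments A x|)).
    rewrite -sum1_card big_distrr /=; apply: leq_sum => z zp; rewrite muln1.
    have [w wA nzw] := many z zp.
    exact: card_attachments_ge Gr (part_notin zp) wA nzw.
  rewrite sum_part_degree -sum_nat_const; apply: leq_sum => b bA; exact: vmax.
have back := card_parts_put_back vA.
have cA : #|A| = #|A :\ v|.+1 by rewrite (cardsD1 v A) vA.
have lA' : linked (A :\ v) by apply: linkedS lA; apply: subsetDl.
have lt_s : (#|A :\ v| < s)%N by lia.
pose d := (part_degree A v - 2)%N; have dE : part_degree A v = d.+2 by lia.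
suff [n' le] : exists n', potential r n (#|A|%:R : R) #|parts A|%:R <=
    potential r n' #|A :\ v|%:R #|parts (A :\ v)|%:R.
  have [X [XA Xn Xb]] := IH _ n' lt_s lA'; exists X; split=> //.
    exact: subset_trans XA (subsetDl _ _).
  exact: le_trans le Xb.
have gain n' : (n' <= d)%N -> potential r n' (#|A|%:R : R) #|parts A|%:R <=
    potential r n' #|A :\ v|%:R #|parts (A :\ v)|%:R.
  move=> n'd; apply: potential_homo => //.
  rewrite cA lerBlDr addrAC lerBrDr -!natrM -!natrD ler_nat; nia.
(* If the degree reaches [n.+2], the same index works. Otherwise lower it to [d], which by [rk] does
   not decrease the potential, and then take the step. *)
have [nd|dn] := leqP n d; first by exists n; apply: gain.
exists d; apply: le_trans (gain d (leqnn d)).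
apply: potential_mono => //; rewrite ?ler0n //; first exact: ltnW.
by rewrite -!natrM ler_nat -dE mulnC [(_ * #|A|)%N]mulnC mulnC.
Qed.

Lemma r_connected_connect x y : connect (@adj G) x y.
Proof.
case: Gr => _ /(_ set0); rewrite cards0 => /(_ _ x y).
rewrite !inE => /(_ _ isT isT) h; apply: connect_sub (h _); last by lia.
by move=> u v /= /and3P[_ _ uv]; apply: connect1.
Qed.

Lemma r_connected_card : (1 < #|G|)%N.
Proof. by case: Gr => h _; lia. Qed.

Lemma linked_half K : exists A, [/\ A \subset K, linked A & (#|K| <= 2 * #|A|)%N].
Proof.
have [X Xc] := max_cut_connected r_connected_connect.
have link A : (forall u v, u \in A -> v \in A -> (u \in X) = (v \in X)) -> linked A.
  move=> mono x y; apply: connect_sub (Xc x y) => u v /andP[uv ne].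
  by apply: connect1; rewrite /= uv; apply: contra ne => /andP[uA vA]; rewrite (mono u v).
have := cardsID X K; have [le|lt] := leqP #|K :\: X| #|K :&: X| => cK.
  exists (K :&: X); split; [exact: subsetIl | | lia].
  by apply: link => u v; rewrite !inE => /andP[_ ->] /andP[_ ->].
exists (K :\: X); split; [exact: subsetDl | | lia].
by apply: link => u v; rewrite !inE => /andP[/negbTE-> _] /andP[/negbTE-> _].
Qed.
End Greedy.

(** The set [X] found for [K] lies among the leaves of one spanning tree; [t <= 1] takes care of the
    default value of the minimum. *)
Lemma robust_connectivity_ge (R : realType) (G : sgraph) (t : R) :
  (1 < #|G|)%N -> t <= 1 ->
  (forall K : {set G}, K != set0 -> exists X : {set G}, [/\ X \subset K, linked X,
     nonseparating X & t * #|K|%:R <= #|X|%:R]) ->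
  t <= robust_connectivity G R.
Proof.
move=> G1 t1 H; apply: le_bigmin => // K K0; have [X [XK lX nX tX]] := H K K0.
have [F FT XF] := spanning_tree_with_leaves nX (fun a => linked_dominated G1 lX).
apply: (bigmax_sup F) => //; rewrite ler_pdivlMr ?ltr0n ?card_gt0 //.
apply: (le_trans tX); rewrite ler_nat; apply: subset_leq_card.
by rewrite subsetI XK.
Qed.

(** * Lower bounds on robust connectivity from the Euler genus *)

Section Bounds.
Variables (R : realType) (G : sgraph) (r g : nat).
Hypotheses (r_gt2 : (2 < r)%N) (Gr : r_connected r G) (genus : has_euler_genus G g).

Lemma parts_le_genus (A : {set G}) : (1 < #|parts A|)%N ->
  (r * #|parts A| + 4 <= 2 * (#|A| + #|parts A|) + 2 * g)%N.
Proof.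
case: genus => -[S [[M [cM sM]] gE]] _ k2.
apply: (parts_euler _ sM Gr r_gt2 k2).
by rewrite -gE; case: S cM {gE} => k [].
Qed.

Lemma parts_le_linear (A : {set G}) : (1 < #|parts A|)%N ->
  (#|parts A| <= 2 * #|A| + 2 * g.+1)%N.
Proof.
move=> /parts_le_genus.
have : (3 * #|parts A| <= r * #|parts A|)%N by rewrite leq_mul2r r_gt2 orbT.
move: (r * _)%N => rk; lia.
Qed.

(** For [g <= 2] the Euler bound becomes [(r - 2) * #|parts A| <= 2 * #|A|], so the initial
    potential is at least a fixed multiple of [#|A|]. The 2 beside [t] is the loss in
    [linked_half]. *)
Lemma robust_connectivity_low_genus n (t : R) : (g <= 2)%N -> t <= 2%:R^-1 ->
  0 <= t ->
  t * 2 <= density R r n / n.+1%:R * (n.+1%:R - 2%:R / (r%:R - 2)) ->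
  t <= robust_connectivity G R.
Proof.
move=> g2 t2 t0 tn; apply: robust_connectivity_ge; [exact: r_connected_card Gr | lra |].
move=> K K0; have [A [AK lA KA]] := linked_half r_gt2 Gr K.
have KA' : (#|K|%:R : R) <= 2 * #|A|%:R by rewrite -natrM ler_nat.
have tK : t * #|K|%:R <= t * 2 * #|A|%:R by rewrite -mulrA; apply: ler_wpM2l.
have [k1|k2] := leqP #|parts A| 1.
  exists A; split=> //; first exact: few_parts_nonseparating.
  by apply: (le_trans tK); have : (0 : R) <= #|A|%:R by []; nra.
have [X [XA Xn Xb]] := greedy_nonseparating R r_gt2 Gr n lA.
exists X; split=> //; [exact: subset_trans XA AK | exact: linkedS lA |].
apply: (le_trans tK); apply: le_trans Xb.
apply: (@le_trans _ _ (density R r n / n.+1%:R * (n.+1%:R - 2%:R / (r%:R - 2)) * #|A|%:R)).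
  by apply: ler_wpM2r.
rewrite /potential -mulrA; apply: ler_wpM2l.
  by have /andP[d0 _] := density_bounds R r_gt2 n; rewrite divr_ge0 // ltW.
have r2 : (0 : R) < r%:R - 2 by rewrite subr_gt0 ltr_nat.
rewrite mulrBl lerB // mulrAC ler_pdivlMr // mulrBr -natrM [#|_|%:R * _]mulrC.
rewrite -!natrM lerBlDr -natrD ler_nat; have := parts_le_genus k2; lia.
Qed.

Lemma robust_connectivity_genus :
  27^-1 * (g.+1%:R `^ (- r%:R^-1)) <= robust_connectivity G R.
Proof.
pose m := r.-1; have m2 : (2 <= m)%N by rewrite /m; lia.
pose s : R := g.+1%:R `^ r%:R^-1.
have r0 : (r%:R : R) != 0 by rewrite pnatr_eq0; lia.
have sr : s ^+ r = g.+1%:R.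
  by rewrite -powR_mulrn ?powR_ge0 // -powRrM mulVf // powRr1 // ler0n.
have smE : s * s ^+ m = g.+1%:R.
  by rewrite -exprS /m prednK ?sr // (ltn_trans _ r_gt2).
have s1 : 1 <= s.
  have := @ler_powR R g.+1%:R _ 0 (r%:R^-1); rewrite powRr0; apply.
    by rewrite ler1n.
  by rewrite invr_ge0 ler0n.
rewrite powRN -/s.
have s0 : 0 < s by lra.
have t27 : 0 < 27^-1 / s :> R by rewrite divr_gt0 ?invr_gt0 //; lra.
have tE : 27 * (27^-1 / s) * s = 1 :> R by field; lra.
move: (27^-1 / s) t27 tE => t t0 tE.
have t1 : 27 * t <= 1 by nra.
apply: robust_connectivity_ge; [exact: r_connected_card Gr | lra |].
move=> K K0; have [A [AK lA KA]] := linked_half r_gt2 Gr K.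
have KA' : (#|K|%:R : R) <= 2 * #|A|%:R by rewrite -natrM ler_nat.
have [a aA] : exists a, a \in A.
  by apply/card_gt0P; move: K0; rewrite -card_gt0; lia.
have A0 : (1 : R) <= #|A|%:R by rewrite ler1n; apply/card_gt0P; exists a.
(* In the small case [t * #|K|] is at most [27 * t * s = 1], so a single leaf is enough. *)
have [small|big] := leP (2 * #|A|%:R) (27 * s).
  have aK : [set a] \subset A by rewrite sub1set.
  exists [set a]; split; [exact: subset_trans aK AK | exact: linkedS lA | |].
    by case: Gr => _ conn x y; apply: conn; rewrite cards1; exact: ltnW r_gt2.
  rewrite cards1; nra.
have [k1|k2] := leqP #|parts A| 1.
  exists A; split=> //; first exact: few_parts_nonseparating.
  nra.
(* With index [q.+1] the number of components is at most half of [q.+2 * #|A|], so the potential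
   loses at most half of [density * #|A|]. *)
pose q := (2 * #|parts A| %/ #|A|)%N.
have [X [XA Xn Xb]] := greedy_nonseparating R r_gt2 Gr q.+1 lA.
exists X; split=> //; [exact: subset_trans XA AK | exact: linkedS lA |].
apply: le_trans Xb.
have q1 : (2 * #|parts A| <= q.+2 * #|A|)%N.
  have A1 : (0 < #|A|)%N by apply/card_gt0P; exists a.
  apply: leq_trans (ltnW (ltn_ceil (2 * #|parts A|) A1)) _.
  by rewrite -/q leq_mul2r leqnSn orbT.
have q2 : (q * #|A| <= 2 * #|parts A|)%N by apply: leq_trunc_div.
have keul := parts_le_linear k2.
have /andP[d0 d1] := density_bounds R r_gt2 q.+1.
have dl := density_lower R r_gt2 q.
set dd := density R r q.+1 in d0 d1 dl *.
have Xd : dd * #|A|%:R <= 2 * potential r q.+1 #|A|%:R #|parts A|%:R.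
  rewrite /potential -/dd.
  have q1' : 2 * (#|parts A|%:R : R) <= q.+2%:R * #|A|%:R by rewrite -!natrM ler_nat.
  have -> : 2 * (dd / q.+2%:R * (q.+2%:R * #|A|%:R - #|parts A|%:R)) =
    dd * #|A|%:R + dd / q.+2%:R * (q.+2%:R * #|A|%:R - 2 * #|parts A|%:R).
    by field; rewrite -natrD pnatr_eq0.
  by rewrite lerDl mulr_ge0 ?divr_ge0 ?subr_ge0 // ltW.
(* It suffices that [dd / 2 >= 2 * t], where [t = 1 / (27 * s)]. *)
suff : 4 <= 27 * (dd * s) by nra.
have sm1 : 1 <= s ^+ m by apply: exprn_ege1.
(* From [keul], [q] is at most [4 + 4 * s ^ r / #|A|], and [big] bounds the fraction by
   [(8 / 27) * s ^ m]. *)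
have qb : (q.+1%:R : R) <= 6 * s ^+ m.
  have h1 : (q%:R : R) * #|A|%:R <= 2 * #|parts A|%:R by rewrite -!natrM ler_nat.
  have h2 : (#|parts A|%:R : R) <= 2 * #|A|%:R + 2 * (s * s ^+ m).
    by rewrite smE -!natrM -natrD ler_nat.
  rewrite -natr1; move: (s ^+ m) (q%:R) (#|A|%:R) (#|parts A|%:R) sm1 h1 h2 A0 big.
  move=> S Q z k S1 h1 h2 z1 zs.
  suff : Q * z <= (4 + S * (8 / 27)) * z by rewrite ler_pM2r; lra.
  have : s * S <= 2 / 27 * z * S by apply: ler_wpM2r; lra.
  by lra.
(* Otherwise [2 * dd * s < 8 / 27], and [density_lower] with [qb] would give
   [1 <= 6 * (8 / 27) ^ 2], which is false. *)
rewrite leNgt; apply/negP=> lt.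
have : (2 * dd) ^+ m * q.+1%:R <= (2 * dd * s) ^+ m * 6.
  rewrite [X in _ <= X * _]exprMn -mulrA; apply: ler_wpM2l; last by rewrite mulrC.
  by apply: exprn_ge0; lra.
have : (2 * dd * s) ^+ m <= (8 / 27) ^+ 2.
  apply: (@le_trans _ _ ((8 / 27) ^+ m)).
    by apply: lerXn2r; rewrite ?nnegrE ?mulr_ge0 //; lra.
  by apply: ler_wiXn2l; [lra | lra |].
move: dl; rewrite -/m; lra.
Qed.
End Bounds.

Theorem theorem7 (R : realType) (r : nat) (G : sgraph) (g : nat)
  (hr : (3 <= r)%N) (hconn : r_connected r G) (hgenus : has_euler_genus G g) :
  27^-1 * (g.+1%:R `^ (- r%:R^-1)) <= robust_connectivity G R /\
  ((g <= 2)%N ->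
    [/\ r = 3%N -> 21 / 256 <= robust_connectivity G R,
        r = 4%N -> 5 / 27 <= robust_connectivity G R,
        r = 5%N -> 49 / 192 <= robust_connectivity G R &
        r = 6%N -> 3 / 10 <= robust_connectivity G R]).
Proof.
split; first exact: robust_connectivity_genus.
move=> g2; split=> rE; subst r.
(* In each case [n] is the least index with [n + 2 >= 2 r / (r - 2)]; by the comparison in
   [potential_step] it maximizes the potential at [k = 2 z / (r - 2)]. *)
- apply: (robust_connectivity_low_genus hr hconn hgenus (n := 4)) => //; try lra.
  rewrite /density !big_ord_recr big_ord0 /=.
  by rewrite [X in _ <= X](_ : _ = 21 / 128); [lra | field].
- apply: (robust_connectivity_low_genus hr hconn hgenus (n := 2)) => //; try lra.
  rewrite /density !big_ord_recr big_ord0 /=.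
  by rewrite [X in _ <= X](_ : _ = 10 / 27); [lra | field].
- apply: (robust_connectivity_low_genus hr hconn hgenus (n := 2)) => //; try lra.
  rewrite /density !big_ord_recr big_ord0 /=.
  by rewrite [X in _ <= X](_ : _ = 49 / 96); [lra | field].
apply: (robust_connectivity_low_genus hr hconn hgenus (n := 1)) => //; try lra.
rewrite /density !big_ord_recr big_ord0 /=.
by rewrite [X in _ <= X](_ : _ = 3 / 5); [lra | field].
Qed.
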